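(* Let $(A,\le)$ be a standardly stratified algebra with characteristic module $T$, and let $s\ge 0$ be an integer. Then $\overline{\nabla}\text{-}\mathrm{gfd}(A)=s$ if and only if $\mathrm{proj.dim}_A T=s$.
   Context: Setting: $R$ is a commutative Artin ring, $A$ is a basic Artin $R$-algebra, and $A\text{-mod}$ is the category of finitely generated left $A$-modules. Fix an ordered complete set $e_1,\dots,e_n$ of primitive orthogonal idempotents of $A$; put $\Lambda=\{1,\dots,n\}$ with its natural order $\le$. For $i\in\Lambda$, $P(i)=Ae_i$, $E(i)$ is the simple top of $P(i)$, and $I(i)$ is the injective envelope of $E(i)$. Standard and proper costandard modules: $\Delta(i)$ is the maximal factor module of $P(i)$ having no composition factor $E(j)$ with $j>i$. Dually, the costandard module $\nabla(i)$ is the maximal submodule of $I(i)$ having no composition factor $E(j)$ with $j>i$, and the proper costandard module $\overline{\nabla}(i)$ is the maximal submodule of $\nabla(i)$ in which $E(i)$ occurs as a composition factor with multiplicity exactly $1$. For a class $\Theta$ of $A$-modules, $\mathcal F(\Theta)$ is the full subcategory of $A\text{-mod}$ of modules having a finite filtration whose successive factors are isomorphic to objects of $\Theta$. Here $\Delta=\{\Delta(i)\}_{i\in\Lambda}$ and $\overline{\nabla}=\{\overline{\nabla}(i)\}_{i\in\Lambda}$. $(A,\le)$ is standardly stratified if ${}_AA\in\mathcal F(\Delta)$. In that case there is a unique basic module $T$, the characteristic module (a generalized tilting module), with $\mathrm{add}(T)=\mathcal F(\Delta)\cap\mathcal F(\overline{\nabla})$. For $X\in A\text{-mod}$, $\overline{\nabla}\text{-}\mathrm{gfd}(X)$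 is the smallest $d\ge0$ for which there is an exact sequence $0\to X\to M_0\to\cdots\to M_d\to0$ with all $M_i\in\mathcal F(\overline{\nabla})$ (such a finite sequence always exists). The $\overline{\nabla}$-good filtration dimension of the algebra $A$ is $\overline{\nabla}\text{-}\mathrm{gfd}(A)=\sup\{\overline{\nabla}\text{-}\mathrm{gfd}(X): X\in A\text{-mod}\}$. *)

(* Defs.v *)
From HB Require Import structures.
From mathcomp Require Import all_boot all_order all_algebra generic_quotient ring_quotient.
From mathcomp Require Import boolp.

Set Implicit Arguments.
Unset Strict Implicit.
Unset Printing Implicit Defensive.

Import GRing.Theory.
Local Open Scope ring_scope.
Local Open Scope quotient_scope.

(* Submodules are boolean predicates; with the classical axioms of boolp these
   are the same as arbitrary subsets. *)
Notation submodule := submodClosed.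

Section SubAndQuotientModules.
Context {K : pzRingType} {V : lmodType K}.
Implicit Types U W : submodule V.

Definition submod W : Type := {x : V | x \in W}.
HB.instance Definition _ W := SubChoice.on (submod W).
HB.instance Definition _ W := [SubChoice_isSubLmodule of submod W by <:].

Definition restrict_pred U W : {pred submod W} := fun x => val x \in U.
Arguments restrict_pred U W _ : clear implicits.

Lemma restrict_submod_closed U W : submod_closed (restrict_pred U W).
Proof.
split=> [|a x y]; rewrite /in_mem /= /restrict_pred ?raddf0 ?rpred0 // => Ux Uy.
by rewrite raddfD /= rpredD ?rpredZ.
Qed.
HB.instance Definition _ U W :=
  GRing.isSubmodClosed.Build K (submod W) (restrict_pred U W)
    (restrict_submod_closed U W).

(* The same predicate as U, carrying the closure under opposites required by
   the quotient construction. *)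
Definition zmod_of U : {pred V} := fun x => x \in U.

Lemma zmod_of_submod_closed U : submod_closed (zmod_of U).
Proof. exact: (submodClosedP U). Qed.
HB.instance Definition _ U :=
  GRing.isSubmodClosed.Build K V (zmod_of U) (zmod_of_submod_closed U).

Definition quotmod U : Type := Quotient.quot (zmod_of U).
HB.instance Definition _ U := GRing.Zmodule.on (quotmod U).
HB.instance Definition _ U := Quotient.on (quotmod U).

Lemma eq_quotmod U (x y : V) :
  (\pi_(quotmod U) x == \pi_(quotmod U) y) = (x - y \in U).
Proof. exact: (esym (Quotient.idealrBE (zmod_of U) x y)). Qed.

Lemma pi_quotmodD U : {morph \pi_(quotmod U) : x y / x + y}.
Proof. exact: Quotient.pi_add. Qed.

Definition qscale U (a : K) (x : quotmod U) : quotmod U :=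
  \pi_(quotmod U) (a *: repr x).

Lemma pi_qscale U a (x : V) :
  qscale a (\pi_(quotmod U) x) = \pi_(quotmod U) (a *: x).
Proof.
by apply/eqP; rewrite eq_quotmod -scalerBr rpredZ // -eq_quotmod reprK.
Qed.

Lemma qscaleA U a b (x : quotmod U) :
  qscale a (qscale b x) = qscale (a * b) x.
Proof. by rewrite -[x]reprK (pi_qscale _ b) !pi_qscale scalerA. Qed.

Lemma qscale1 U : left_id 1 (@qscale U).
Proof. by move=> x; rewrite -[x]reprK pi_qscale scale1r. Qed.

Lemma qscaleDr U : right_distributive (@qscale U) +%R.
Proof.
move=> a x y.
by rewrite -[x]reprK -[y]reprK -pi_quotmodD !pi_qscale scalerDr pi_quotmodD.
Qed.

Lemma qscaleDl U (x : quotmod U) : {morph (@qscale U)^~ x : a b / a + b}.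
Proof.
by move=> a b; rewrite -[x]reprK !pi_qscale scalerDl pi_quotmodD.
Qed.

HB.instance Definition _ U :=
  GRing.Zmodule_isLmodule.Build K (quotmod U)
    (@qscaleA U) (@qscale1 U) (@qscaleDr U) (@qscaleDl U).

Definition submodule_le U W : Prop := {subset U <= W}.

Definition is_maximal_submodule U : Prop :=
  ~ (forall x, x \in U) /\
  forall W, submodule_le U W -> submodule_le W U \/ (forall x, x \in W).

Definition is_greatest_submodule (Q : submodule V -> Prop) U : Prop :=
  Q U /\ forall W, Q W -> submodule_le W U.

Definition is_least_submodule (Q : submodule V -> Prop) U : Prop :=
  Q U /\ forall W, Q W -> submodule_le U W.

Definition rad_pred : {pred V} :=
  fun x => `[< forall U, is_maximal_submodule U -> x \in U >].

Lemma rad_submod_closed : submod_closed rad_pred.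
Proof.
split=> [|a x y]; first by apply/asboolP => U _; exact: rpred0.
move=> /asboolP rx /asboolP ry; apply/asboolP => U mU.
by rewrite rpredD ?rpredZ ?rx ?ry.
Qed.
HB.instance Definition _ :=
  GRing.isSubmodClosed.Build K V rad_pred rad_submod_closed.

End SubAndQuotientModules.

Arguments restrict_pred {K V} U W _.

Section Modules.
Context {K : pzRingType}.
Implicit Types P Q U V W S M N X T : lmodType K.

(* W / U, used when U is contained in W *)
Definition factor V (U W : submodule V) : lmodType K :=
  quotmod (restrict_pred U W).

Definition top_module V : lmodType K := quotmod (@rad_pred K V).

Definition fin_gen V : Prop :=
  exists m (g : 'I_m -> V), forall v,
    exists c : 'I_m -> K, v = \sum_(i < m) c i *: g i.

Definition is_zero V : Prop := forall v : V, v = 0.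

Definition iso V W : Prop := exists f : {linear V -> W}, bijective f.

Definition simple_module V : Prop :=
  ~ is_zero V /\
  forall U : submodule V, (forall x, x \in U -> x = 0) \/ (forall x, x \in U).

Definition indecomposable V : Prop :=
  ~ is_zero V /\
  forall U W, iso V (U * W)%type -> is_zero U \/ is_zero W.

(* V is the direct sum of finitely many indecomposable, pairwise nonisomorphic
   submodules *)
Definition basic_module V : Prop :=
  exists m (N : 'I_m -> submodule V),
    [/\ forall v, exists! x : {ffun 'I_m -> V},
          (forall k, x k \in N k) /\ v = \sum_(k < m) x k,
        forall k, indecomposable (submod (N k))
      & forall k l, k != l -> ~ iso (submod (N k)) (submod (N l))].

Definition add_class T M : Prop :=
  exists m N, iso (M * N)%type {ffun 'I_m -> T}.

Definition surj V W (f : V -> W) : Prop := forall y, exists x, f x = y.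

Definition projective P : Prop :=
  forall M N (g : {linear M -> N}) (f : {linear P -> N}), surj g ->
    exists h : {linear P -> M}, forall x, g (h x) = f x.

Definition injective_module Q : Prop :=
  forall M N (g : {linear M -> N}) (f : {linear M -> Q}), injective g ->
    exists h : {linear N -> Q}, forall x, h (g x) = f x.

Definition injective_envelope S Q : Prop :=
  injective_module Q /\
  exists iota : {linear S -> Q},
    injective iota /\
    forall U : submodule Q, (exists2 x, x \in U & x != 0) ->
      exists2 y, y != 0 & iota y \in U.

Definition chain M (l : nat) (N : nat -> submodule M) : Prop :=
  [/\ forall x, x \in N 0%N -> x = 0,
      forall x, x \in N l
    & forall k, (k < l)%N -> submodule_le (N k) (N k.+1)].

Definition filtered (Theta : lmodType K -> Prop) M : Prop :=
  exists l (N : nat -> submodule M), chain l N /\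
    forall k, (k < l)%N ->
      exists2 X, Theta X & iso (factor (N k) (N k.+1)) X.

Definition composition_series M (l : nat) (N : nat -> submodule M) : Prop :=
  chain l N /\ forall k, (k < l)%N -> simple_module (factor (N k) (N k.+1)).

(* [M : S] = c; independent of the series by Jordan-Hoelder *)
Definition multiplicity M S (c : nat) : Prop :=
  exists l (N : nat -> submodule M), composition_series l N /\
    #|[pred k : 'I_l | `[< iso (factor (N k) (N k.+1)) S >]]| = c.

Definition composition_factor M S : Prop :=
  exists2 c, (0 < c)%N & multiplicity M S c.

(* ... -> 0 -> P d -> ... -> P 0 -> X -> 0 *)
Definition projective_resolution X (d : nat) : Prop :=
  exists (P : nat -> lmodType K) (eps : {linear P 0%N -> X})
         (del : forall k, {linear P k.+1 -> P k}),
    [/\ surj eps,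
        forall x, eps x = 0 <-> exists y, del 0%N y = x,
        forall k x, del k x = 0 <-> exists y, del k.+1 y = x,
        forall k, (k <= d)%N -> projective (P k)
      & forall k, (d < k)%N -> is_zero (P k)].

(* 0 -> X -> M 0 -> ... -> M d -> 0 -> ... *)
Definition coresolution (C : lmodType K -> Prop) X (d : nat) : Prop :=
  exists (M : nat -> lmodType K) (eta : {linear X -> M 0%N})
         (del : forall k, {linear M k -> M k.+1}),
    [/\ injective eta,
        forall x, del 0%N x = 0 <-> exists y, eta y = x,
        forall k x, del k.+1 x = 0 <-> exists y, del k y = x,
        forall k, (k <= d)%N -> C (M k)
      & forall k, (d < k)%N -> is_zero (M k)].

Definition smallest (Q : nat -> Prop) (d : nat) : Prop :=
  Q d /\ forall d', Q d' -> (d <= d')%N.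

Definition proj_dim_eq X (d : nat) : Prop :=
  smallest (projective_resolution X) d.

End Modules.

Definition artinian_ring (R : comNzRingType) : Prop :=
  forall I : nat -> submodule R^o,
    (forall k, submodule_le (I k.+1) (I k)) ->
    exists k, forall m, (k <= m)%N -> submodule_le (I k) (I m).

Definition artin_algebra (R : comNzRingType) (A : algType R) : Prop :=
  artinian_ring R /\ fin_gen A.

Section StratifiedAlgebras.
Context {A : nzRingType}.

Definition primitive_idempotent (e : A) : Prop :=
  [/\ e != 0, e * e = e
    & forall f g : A, f * f = f -> g * g = g -> f * g = 0 -> g * f = 0 ->
        e = f + g -> f = 0 \/ g = 0].

Definition left_ideal_pred (a : A) : {pred A^o} :=
  fun x => `[< exists b : A, x = b * a >].

Lemma left_ideal_submod_closed a : submod_closed (left_ideal_pred a).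
Proof.
split=> [|c x y]; first by apply/asboolP; exists 0; rewrite mul0r.
move=> /asboolP [b ->] /asboolP [b' ->]; apply/asboolP.
by exists (c * b + b'); rewrite mulrDl -mulrA.
Qed.
HB.instance Definition _ a :=
  GRing.isSubmodClosed.Build A A^o (left_ideal_pred a)
    (left_ideal_submod_closed a).

Context {n : nat} (e : 'I_n -> A).

Definition complete_primitive_orthogonal : Prop :=
  [/\ forall i, primitive_idempotent (e i),
      forall i j, i != j -> e i * e j = 0
    & \sum_(i < n) e i = 1].

Definition Pmod (i : 'I_n) : lmodType A := submod (left_ideal_pred (e i)).

Definition Emod (i : 'I_n) : lmodType A := top_module (Pmod i).

Definition basic_algebra : Prop :=
  forall i j, i != j -> ~ iso (Pmod i) (Pmod j).

Definition no_factor_above (i : 'I_n) (M : lmodType A) : Prop :=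
  forall j : 'I_n, (i < j)%N -> ~ composition_factor M (Emod j).

(* The families Delta and nablabar are given as classes of modules: the
   members of index i are Delta(i), resp. nablabar(i). *)
Definition standard (i : 'I_n) (D : lmodType A) : Prop :=
  exists2 U : submodule (Pmod i),
    is_least_submodule (fun W => no_factor_above i (quotmod W)) U
    & D = quotmod U.

Definition Delta (D : lmodType A) : Prop := exists i, standard i D.

Definition standardly_stratified : Prop := filtered Delta A^o.

Context (I : 'I_n -> lmodType A).

Definition costandard (i : 'I_n) (N : submodule (I i)) : Prop :=
  is_greatest_submodule (fun W => no_factor_above i (submod W)) N.

Definition proper_costandard (i : 'I_n) (X : lmodType A) : Prop :=
  exists2 N : submodule (I i), costandard N &
  exists2 L : submodule (submod N),
    is_greatest_submodule (fun W => multiplicity (submod W) (Emod i) 1) L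
    & X = submod L.

Definition nablabar (X : lmodType A) : Prop := exists i, proper_costandard i X.

Definition characteristic_module (T : lmodType A) : Prop :=
  [/\ fin_gen T, basic_module T
    & forall M, add_class T M <-> filtered Delta M /\ filtered nablabar M].

Definition nablabar_gfd_eq (X : lmodType A) (d : nat) : Prop :=
  smallest (coresolution (filtered nablabar) X) d.

Definition nablabar_gfd_bound (u : nat) : Prop :=
  forall X : lmodType A, fin_gen X ->
    exists2 d, nablabar_gfd_eq X d & (d <= u)%N.

(* The supremum, taken in the natural numbers with infinity, equals s. *)
Definition nablabar_gfd_algebra_eq (s : nat) : Prop :=
  smallest nablabar_gfd_bound s.

End StratifiedAlgebras.

(* Main.v *)
(** Everything is reduced to the vanishing of Ext^1 and dimension shifting.  By
    Hopkins' theorem for R, finitely generated A-modules have finite length, so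
    [E(l)] is a composition factor of M if and only if [e_l M <> 0].  Write
    [tr_j M] for the submodule generated by the [e_l M] with [l > j].  If M has a
    standard filtration, [tr_j M] keeps exactly the layers Delta(l) with [l > j];
    hence Ext^1(Delta(l), Y) = 0 for all [l > j] already forces Ext^1(K, Y) = 0 for
    the syzygy K of Delta(j).  Two consequences: the class of Y with Ext^1(Delta, Y) = 0
    is closed under cokernels of monomorphisms, and Delta(j) has finite projective
    dimension.

    A nonzero finitely generated Y with Ext^1(Delta, Y) = 0 contains some
    nablabar(i): for the least i such that E(i) embeds in Y one has
    Ext^1(E(j), Y) = 0 for all j < i, so the embedding extends along
    E(i) -> nablabar(i).  Iterating, Y has a nablabar-filtration.

    If proj.dim T <= s, let Z be an s-th cosyzygy.  Then Ext^1(T, Z) = 0, and the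
    universal extensions 0 -> Delta(j) -> T0 -> X1 -> 0 with T0 in add(T) and X1 in
    F(Delta), together with the finiteness of proj.dim Delta(j), give
    Ext^1(Delta, Z) = 0; so Z has a nablabar-filtration.  Conversely, a
    nablabar-coresolution of length s of every Z shows Ext^1(Omega^s T, Z) = 0, so
    that Omega^s T is projective. *)
Require Import Defs.
From HB Require Import structures.
From mathcomp Require Import all_boot all_algebra.
From mathcomp Require Import boolp.
From mathcomp Require classical_sets.

Set Implicit Arguments.
Unset Strict Implicit.
Unset Printing Implicit Defensive.

Import GRing.Theory.
Local Open Scope ring_scope.
Local Open Scope quotient_scope.

(** * Exact sequences and the vanishing of Ext *)

(** Ext is never built as a derived functor: [ext0] states the vanishing of Ext^1, and a vanishing
    higher Ext is expressed as [ext0] of a syzygy or against a cosyzygy. Two exchange lemmas,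
    [ext0_cosyzygy] and [ext0_syzygy], then do all the dimension shifting. The vanishing of Ext^1(T,
    Z) does not by itself give Ext^1(Delta, Z) = 0. Since Delta(j) embeds in T0 with cokernel in
    F(Delta), the vanishing for Z follows from that for the next cosyzygy of Z. This is a descending
    induction on the cosyzygy index, and the finite projective dimension of Delta(j) is what starts
    it, far enough out. The universal extensions need Hom_A(M, N) to be finitely generated over R:
    only then do finitely many pushouts suffice, so that T0 is finitely generated and can be shown
    to lie in add(T). *)

Section LinearMaps.
Context {K : pzRingType}.
Implicit Types V W X Y Z M N P Q T U : lmodType K.

Lemma ex_lin V W (f : V -> W) :
  linear f -> exists g : {linear V -> W}, forall x, g x = f x.
Proof.
move=> f_lin; pose m := GRing.isLinear.Build K V W *:%R f f_lin.
by exists (HB.pack f m : {linear V -> W}).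
Qed.

(** Submodules are handled as plain predicates, so that kernels, images and traces need no bundling;
    [ex_submodule] returns to the bundled form. *)
Definition lin_closed V (P : V -> Prop) : Prop :=
  P 0 /\ forall a x y, P x -> P y -> P (a *: x + y).

Lemma closedD V (P : V -> Prop) x y : lin_closed P -> P x -> P y -> P (x + y).
Proof. by case=> _ cP Px Py; rewrite -[x]scale1r; exact: cP. Qed.

Lemma closedZ V (P : V -> Prop) a x : lin_closed P -> P x -> P (a *: x).
Proof. by case=> P0 cP Px; rewrite -[_ *: _]addr0; exact: cP. Qed.

Lemma closedN V (P : V -> Prop) x : lin_closed P -> P x -> P (- x).
Proof. by move=> cP Px; rewrite -scaleN1r; exact: closedZ. Qed.

Lemma closedB V (P : V -> Prop) x y : lin_closed P -> P x -> P y -> P (x - y).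
Proof. by move=> cP Px Py; apply: closedD => //; exact: closedN. Qed.

Lemma closed_submodule V (U : submodule V) : lin_closed (fun x => x \in U).
Proof. by split=> [|a x y Ux Uy]; rewrite ?rpred0 // rpredD // rpredZ. Qed.

Lemma closed_all V : lin_closed (fun _ : V => True). Proof. by []. Qed.

Lemma closed_zero V : lin_closed (fun x : V => x = 0).
Proof. by split=> // a x y -> ->; rewrite scaler0 addr0. Qed.

Lemma closed_preim V W (f : {linear V -> W}) (P : W -> Prop) :
  lin_closed P -> lin_closed (fun x => P (f x)).
Proof. by case=> P0 cP; split=> [|a x y]; rewrite ?linear0 // linearP; exact: cP. Qed.

Lemma closed_im V W (f : {linear V -> W}) (P : V -> Prop) :
  lin_closed P -> lin_closed (fun y => exists2 x, P x & f x = y).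
Proof.
case=> P0 cP; split=> [|a _ _ [x Px <-] [y Py <-]].
  by exists 0; rewrite ?linear0.
by exists (a *: x + y); [exact: cP | rewrite linearP].
Qed.

Lemma closed_range V W (f : {linear V -> W}) :
  lin_closed (fun y => exists x, f x = y).
Proof.
split=> [|a _ _ [x <-] [y <-]]; first by exists 0; rewrite linear0.
by exists (a *: x + y); rewrite linearP.
Qed.

Lemma closed_add V (P Q : V -> Prop) : lin_closed P -> lin_closed Q ->
  lin_closed (fun x => exists y z, [/\ P y, Q z & x = y + z]).
Proof.
move=> [P0 cP] [Q0 cQ]; split=> [|a _ _ [y [z [Py Qz ->]]] [y' [z' [Py' Qz' ->]]]].
  by exists 0, 0; rewrite addr0.
exists (a *: y + y'), (a *: z + z'); split; [exact: cP | exact: cQ |].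
by rewrite scalerDr addrACA.
Qed.

Section Psub.
Context {V : lmodType K} (P : V -> Prop) (cP : lin_closed P).
(** The idle [let] makes [psub] depend on [cP], from which the instance below takes its closure
    proof. *)
Definition psub : {pred V} := let _ := cP in fun x => `[< P x >].
Lemma psub_submod_closed : submod_closed psub.
Proof.
case: (cP) => P0 cP'; split=> [|a x y]; first exact/asboolP.
by move=> /asboolP Px /asboolP Py; apply/asboolP; exact: cP'.
Qed.
HB.instance Definition _ :=
  GRing.isSubmodClosed.Build K V psub psub_submod_closed.
End Psub.

Lemma ex_submodule V (P : V -> Prop) :
  lin_closed P -> exists U : submodule V, forall x, x \in U <-> P x.
Proof. by move=> cP; exists (psub cP : submodule V) => x; split=> /asboolP. Qed.

Lemma submod_emb V (U : submodule V) : exists g : {linear submod U -> V},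
  (forall x, g x = val x).
Proof. exact: (ex_lin (f := val)). Qed.

Lemma quotmod_proj V (U : submodule V) : exists p : {linear V -> quotmod U},
  surj p /\ forall x, p x = 0 <-> x \in U.
Proof.
have [|p pE] := @ex_lin V (quotmod U) (\pi_(quotmod U)).
  by move=> a x y; rewrite pi_quotmodD -pi_qscale.
exists p; split=> [y|x]; first by exists (repr y); rewrite pE reprK.
rewrite -{2}(subr0 x) -eq_quotmod -!pE linear0.
by split=> [->|/eqP].
Qed.

Lemma ex_sub V (P : V -> Prop) : lin_closed P ->
  exists (Z : lmodType K) (g : {linear Z -> V}),
    injective g /\ forall x, P x <-> exists z, g z = x.
Proof.
move=> /ex_submodule [U UP]; have [g gE] := submod_emb U.
exists (submod U), g; split=> [x y|x]; first by rewrite !gE => /val_inj.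
split=> [/UP Ux|[z <-]]; first by exists (exist _ x Ux); rewrite gE.
by rewrite gE; apply/UP; case: z.
Qed.

Lemma ex_quo V (P : V -> Prop) : lin_closed P ->
  exists (Q : lmodType K) (p : {linear V -> Q}),
    surj p /\ forall x, p x = 0 <-> P x.
Proof.
move=> /ex_submodule [U UP]; have [p [p_surj pE]] := quotmod_proj U.
exists (quotmod U), p; split=> // x.
by rewrite pE UP.
Qed.

(** Single-valuedness is asked only at 0: the coefficient -1 subtracts two values over the same
    point. Maps defined by a diagram chase are obtained this way. *)
Lemma lin_of_rel V W (r : V -> W -> Prop) :
  (forall x, exists y, r x y) ->
  (forall y, r 0 y -> y = 0) ->
  (forall a x y x' y', r x y -> r x' y' -> r (a *: x + x') (a *: y + y')) ->
  exists g : {linear V -> W}, forall x, r x (g x).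
Proof.
move=> /choice [f rf] r0 rD.
have f_uniq x y : r x y -> y = f x.
  move=> rxy; apply/eqP; rewrite -subr_eq0; apply/eqP/r0.
  have := rD (-1) _ _ _ _ (rf x) rxy.
  by rewrite !scaleN1r addNr addrC.
have [|g gE] := @ex_lin _ _ f; last by exists g => x; rewrite gE.
by move=> a x y; apply/esym/f_uniq/rD.
Qed.

Lemma factor_surj M X Y (p : {linear M -> X}) (h : {linear M -> Y}) :
  surj p -> (forall m, p m = 0 -> h m = 0) ->
  exists h' : {linear X -> Y}, forall m, h' (p m) = h m.
Proof.
move=> p_surj ph.
have [|||h' h'E] := @lin_of_rel X Y (fun x y => exists2 m, p m = x & h m = y).
- by move=> x; have [m <-] := p_surj x; exists (h m), m.
- by move=> y [m /ph -> <-].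
- move=> a x y x' y' [m <- <-] [m' <- <-]; exists (a *: m + m');
  by rewrite linearP.
exists h' => m; have [m' pm <-] := h'E (p m).
by apply/eqP; rewrite -subr_eq0 -linearB ph // linearB pm subrr.
Qed.

Lemma corestrict Z M N (g : {linear Z -> M}) (h : {linear N -> M}) :
  injective g -> (forall n, exists z, g z = h n) ->
  exists h' : {linear N -> Z}, forall n, g (h' n) = h n.
Proof.
move=> g_inj gh; have [|||h' h'E] := @lin_of_rel N Z (fun n z => g z = h n).
- by [].
- by move=> z; rewrite linear0 => z0; apply: g_inj; rewrite linear0.
- by move=> a n z n' z' E E'; rewrite !linearP E E'.
- by exists h'.
Qed.

Lemma inj_lin V W (f : {linear V -> W}) :
  (forall x, f x = 0 -> x = 0) -> injective f.
Proof.
move=> f0 x y fxy; apply/eqP; rewrite -subr_eq0; apply/eqP/f0.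
by rewrite linearB fxy subrr.
Qed.

Lemma inj_eq0 V W (f : {linear V -> W}) x : injective f -> f x = 0 -> x = 0.
Proof. by move=> f_inj fx; apply: f_inj; rewrite linear0. Qed.

Lemma lin_add V W (f g : {linear V -> W}) :
  exists h : {linear V -> W}, forall x, h x = f x + g x.
Proof. by apply: ex_lin => a x y; rewrite !linearP scalerDr addrACA. Qed.

Lemma lin_sub V W (f g : {linear V -> W}) :
  exists h : {linear V -> W}, forall x, h x = f x - g x.
Proof. by apply: ex_lin => a x y; rewrite (linearP f) (linearP g) scalerBr opprD addrACA. Qed.

Lemma lin_zero V W : exists h : {linear V -> W}, forall x, h x = 0.
Proof. by apply: ex_lin => a x y; rewrite scaler0 addr0. Qed.

Lemma lin_inv V W (f : {linear V -> W}) : injective f -> surj f ->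
  exists g : {linear W -> V}, cancel f g /\ cancel g f.
Proof.
move=> f_inj f_surj.
have [g gE] := @corestrict _ _ _ f (idfun : {linear W -> W}) f_inj f_surj.
by exists g; split=> x; [apply: f_inj; rewrite gE | rewrite gE].
Qed.

Lemma isoE V W (f : {linear V -> W}) : injective f -> surj f -> iso V W.
Proof.
move=> f_inj f_surj; have [g [fK gK]] := lin_inv f_inj f_surj.
by exists f; exists g.
Qed.

Lemma iso_mapP V W : iso V W -> exists (f : {linear V -> W}) (g : {linear W -> V}),
  cancel f g /\ cancel g f.
Proof.
case=> f [f' fK f'K]; have [||g gK] := @lin_inv _ _ f; last by exists f, g.
  exact: can_inj fK.
by move=> y; exists (f' y).
Qed.

Lemma iso_sym V W : iso V W -> iso W V.
Proof. by move=> /iso_mapP [f [g [fK gK]]]; exists g, f. Qed.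

Definition ses Z M X (g : {linear Z -> M}) (p : {linear M -> X}) : Prop :=
  [/\ injective g, surj p & forall x, p x = 0 <-> exists z, g z = x].

Lemma ses0 Z M X (g : {linear Z -> M}) (p : {linear M -> X}) z :
  ses g p -> p (g z) = 0.
Proof. by case=> _ _ E; apply/E; exists z. Qed.

Lemma ses_coker Z M (g : {linear Z -> M}) : injective g ->
  exists X (p : {linear M -> X}), ses g p.
Proof.
move=> g_inj; have [X [p [p_surj pE]]] := ex_quo (closed_range g).
by exists X, p.
Qed.

Lemma ses_ker M X (p : {linear M -> X}) : surj p ->
  exists Z (g : {linear Z -> M}), ses g p.
Proof.
move=> p_surj; have [Z [g [g_inj gE]]] := ex_sub (closed_preim p (closed_zero X)).
by exists Z, g.
Qed.

Lemma ses_iso1 Z M X (g : {linear Z -> M}) (p : {linear M -> X}) :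
  ses g p -> is_zero X -> surj g.
Proof. by case=> _ _ E X0 x; apply/E. Qed.

Lemma ses_prod V W : exists (g : {linear V -> (V * W)%type})
  (p : {linear (V * W)%type -> W}), [/\ ses g p, forall v, g v = (v, 0) & forall x, p x = x.2].
Proof.
have [|g gE] := @ex_lin V (V * W)%type (fun v => (v, 0)).
  by move=> a x y; apply/eqP; rewrite xpair_eqE /= scaler0 addr0 !eqxx.
exists g, (snd : {linear (V * W)%type -> W}); split=> //; split=> [x y||x].
- by rewrite !gE => -[].
- by move=> y; exists (0, y).
split=> [/= x2|[z <-]]; last by rewrite gE.
by exists x.1; rewrite gE -x2 -surjective_pairing.
Qed.

Lemma closed_graph V W X Y (f : {linear V -> X}) (h : {linear W -> X}) :
  lin_closed (fun u : (V * W)%type => f u.1 = h u.2).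
Proof.
split=> [|a x y /= E E']; first by rewrite !linear0.
by rewrite !linearP E E'.
Qed.

Lemma pair_lin X V W (f : {linear X -> V}) (g : {linear X -> W}) :
  exists h : {linear X -> (V * W)%type}, forall x, h x = (f x, g x).
Proof. by apply: ex_lin => a x y; apply/eqP; rewrite xpair_eqE /= !linearP !eqxx. Qed.

(** The last clause is the elementwise universal property: every compatible pair comes from the
    pullback. *)
Lemma ses_pullback Z M X (X' : lmodType K) (g : {linear Z -> M}) (p : {linear M -> X})
    (b : {linear X' -> X}) : ses g p ->
  exists M' (g' : {linear Z -> M'}) (p' : {linear M' -> X'}) (c : {linear M' -> M}),
    [/\ ses g' p', forall z, c (g' z) = g z, forall m, p (c m) = b (p' m)
      & forall m x, p m = b x -> exists m', c m' = m /\ p' m' = x].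
Proof.
move=> gp; have [g_inj p_surj E] := gp.
have [M' [i [i_inj iE]]] := ex_sub (closed_graph X p b).
have [o oE] := lin_zero Z X'; have [k kE] := pair_lin g o.
have [|g' g'E] := @corestrict _ _ _ i k i_inj.
  by move=> z; apply/iE; rewrite kE /= oE linear0; apply/E; exists z.
pose c : {linear M' -> M} := (fst : {linear (M * X')%type -> M}) \o i.
pose p' : {linear M' -> X'} := (snd : {linear (M * X')%type -> X'}) \o i.
have ci z : p (i z).1 = b (i z).2 by apply/iE; exists z.
have cov m x : p m = b x -> exists m', c m' = m /\ p' m' = x.
  move=> mx; have /iE [m' m'E] : p (m, x).1 = b (m, x).2 by [].
  by exists m'; rewrite /c /p' /= m'E.
exists M', g', p', c; split=> //; last 1 first.
- by move=> z; rewrite /c /= g'E kE.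
split=> [z z'|x|x].
- by move=> /(congr1 i); rewrite !g'E !kE => -[/g_inj].
- by have [m pm] := p_surj (b x); have [m' [_ <-]] := cov m x pm; exists m'.
split=> [p'x|[z <-]]; last by rewrite /p' /= g'E kE oE.
have /E [z zE] : p (c x) = 0 by rewrite [p (c x)]ci [(i x).2]p'x linear0.
exists z; apply: i_inj; rewrite g'E kE oE zE.
by rewrite -[0]p'x /c /p' /= -surjective_pairing.
Qed.

Lemma pair_split V W (u : (V * W)%type) : u = (u.1, 0) + (0, u.2).
Proof. by case: u => v w; rewrite -[RHS]/(v + 0, 0 + w) addr0 add0r. Qed.

Lemma ses_pushout Z M X Y (g : {linear Z -> M}) (p : {linear M -> X})
    (h : {linear Z -> Y}) : ses g p ->
  exists (E : lmodType K) (g' : {linear Y -> E}) (p' : {linear E -> X}) (c : {linear M -> E}),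
    [/\ ses g' p', forall z, c (g z) = g' (h z) & forall m, p' (c m) = p m].
Proof.
move=> gp; have [g_inj p_surj gpE] := gp.
have cR : lin_closed (fun u : (Y * M)%type => exists z, u = (- h z, g z)).
  split=> [|a _ _ [z ->] [z' ->]]; first by exists 0; rewrite !linear0.
  exists (a *: z + z'); rewrite (linearP h) (linearP g) opprD -scalerN.
  by apply/eqP; rewrite xpair_eqE !eqxx.
have [E [q [q_surj qE]]] := ex_quo cR.
have [o oE] := lin_zero Y M; have [k kE] := pair_lin (idfun : {linear Y -> Y}) o.
have [o' o'E] := lin_zero M Y; have [k' k'E] := pair_lin o' (idfun : {linear M -> M}).
pose g' : {linear Y -> E} := q \o k; pose c : {linear M -> E} := q \o k'.
have qgc u : q u = g' u.1 + c u.2.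
  rewrite /g' /c /= -linearD kE k'E oE o'E /=; congr (q _).
  exact: pair_split.
have [|p' p'E] := @factor_surj _ E X q (p \o snd : {linear (Y * M)%type -> X}) q_surj.
  by move=> u /qE [z ->] /=; apply/gpE; exists z.
have p'c m : p' (c m) = p m by rewrite /c /= p'E /= k'E.
have cg z : c (g z) = g' (h z).
  have : q (- h z, g z) = 0 by apply/qE; exists z.
  rewrite qgc -[(_, _).1]/(- h z) -[(_, _).2]/(g z) (linearN g') addrC.
  by move=> /eqP; rewrite subr_eq0 => /eqP.
exists E, g', p', c; split=> //; split.
- apply: inj_lin => y; rewrite /g' /= => /qE [z].
  rewrite kE oE => -[-> /esym/(inj_eq0 g_inj) ->].
  by rewrite linear0 oppr0.
- by move=> x; have [m <-] := p_surj x; exists (c m).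
move=> e; split=> [p'e|[y <-]]; last by rewrite /g' /= p'E /= kE oE linear0.
have [u ue] := q_surj e; move: p'e; rewrite -ue p'E /= => /gpE [z zE].
exists (u.1 + h z); rewrite -[LHS]/(g' (u.1 + h z)) (qgc u) (linearD g') -zE; congr (_ + _).
exact/esym/cg.
Qed.

(* Ext^1(X, Y) = 0, as an extension property: maps from a submodule to Y extend
   as soon as the quotient is X. *)
Definition ext0 X Y : Prop :=
  forall Z M (g : {linear Z -> M}) (p : {linear M -> X}), ses g p ->
  forall f : {linear Z -> Y}, exists h : {linear M -> Y}, forall z, h (g z) = f z.

Lemma ext0_proj P Y : projective P -> ext0 P Y.
Proof.
move=> projP Z M g p [g_inj p_surj gpE] f.
have [s sE] := projP _ _ p (idfun : {linear P -> P}) p_surj.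
have [d dE] := lin_sub (idfun : {linear M -> M}) (s \o p : {linear M -> M}).
have [|r rE] := @corestrict _ _ _ g d g_inj.
  by move=> m; apply/gpE; rewrite dE /= linearB sE subrr.
exists (f \o r : {linear M -> Y}) => z /=; congr (f _); apply: g_inj.
rewrite rE dE /=; have -> : p (g z) = 0 by apply/gpE; exists z.
by rewrite linear0 subr0.
Qed.

Lemma ext0_inj X Q : injective_module Q -> ext0 X Q.
Proof. by move=> injQ Z M g p [g_inj _ _] f; exact: injQ. Qed.

(** One presentation suffices as a test. With a lift [s] of [q], each element of an extension [M]
    has the form [g z + s x], and the wanted map sends it to [f z + u x], where [u] extends
    [f \o s'] to [P]. *)
Lemma ext0_pres N P X Y (k : {linear N -> P}) (q : {linear P -> X}) :
  projective P -> ses k q ->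
  (forall f : {linear N -> Y}, exists h : {linear P -> Y}, forall x, h (k x) = f x) ->
  ext0 X Y.
Proof.
move=> projP [k_inj q_surj kqE] extP Z M g p [g_inj p_surj gpE] f.
have [s sE] := projP _ _ p q p_surj.
have [|s' s'E] := @corestrict _ _ _ g (s \o k : {linear N -> M}) g_inj.
  by move=> x; apply/gpE; rewrite /= sE; apply/kqE; exists x.
have [u uE] := extP (f \o s').
pose r (m : M) (y : Y) := exists z x, m = g z + s x /\ y = f z + u x.
have [|||h hE] := @lin_of_rel M Y r.
- move=> m; have [x xE] := q_surj (p m).
  have /gpE [z zE] : p (m - s x) = 0 by rewrite linearB sE xE subrr.
  by exists (f z + u x), z, x; rewrite zE subrK.
- move=> _ [z [x [zx ->]]].
  have /kqE [x' x'E] : q x = 0.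
    rewrite -sE -[0](linear0 p) zx linearD.
    by have -> : p (g z) = 0; [apply/gpE; exists z | rewrite add0r].
  rewrite -x'E uE /= -linearD -[RHS](linear0 f); congr (f _); apply: g_inj.
  by rewrite linearD s'E /= x'E linear0 -zx.
- move=> a m y m' y' [z [x [-> ->]]] [z' [x' [-> ->]]].
  exists (a *: z + z'), (a *: x + x').
  by rewrite !linearP !scalerDr -!addrA; split; congr (_ + _); rewrite addrCA.
exists h => z; have [z' [x [gz ->]]] := hE (g z).
have /kqE [x' x'E] : q x = 0.
  rewrite -sE; have -> : s x = g (z - z') by rewrite linearB gz addrC addKr.
  by apply/gpE; exists (z - z').
rewrite -x'E uE /= -linearD; congr (f _); apply: g_inj.
by rewrite linearD s'E /= x'E -gz.
Qed.

(** The pullback along [f] splits by a retraction [r]; then [c - g r] vanishes on [Z] and descends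
    to [X]. *)
Lemma ext0_lift X Z M (Z' : lmodType K) (g : {linear Z -> M}) (p : {linear M -> Z'})
    (f : {linear X -> Z'}) : ext0 X Z -> ses g p ->
  exists h : {linear X -> M}, forall x, p (h x) = f x.
Proof.
move=> eXZ gp; have [M' [g' [p' [c [gp' cg' pc cov]]]]] := ses_pullback f gp.
have [r rE] := eXZ _ _ _ _ gp' (idfun : {linear Z -> Z}).
have [d dE] := lin_sub c (g \o r : {linear M' -> M}).
have [g'_inj p'_surj gpE'] := gp'.
have [|h hE] := @factor_surj _ _ _ p' d p'_surj.
  by move=> m /gpE' [z <-]; rewrite dE /= rE cg' subrr.
exists h => x; have [m <-] := p'_surj x.
by rewrite hE dE linearB pc /= (ses0 _ gp) subr0.
Qed.

(** Cuts an extension of [X] into two stages, over [X1] and then over [X2], so that extensions of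
    maps and filtrations can be built layer by layer. *)
Lemma ses_preim Z M X (X1 X2 : lmodType K) (g : {linear Z -> M}) (p : {linear M -> X})
    (i : {linear X1 -> X}) (q : {linear X -> X2}) : ses g p -> ses i q ->
  exists (M' : lmodType K) (g' : {linear Z -> M'}) (p' : {linear M' -> X1})
      (c : {linear M' -> M}),
    [/\ ses g' p', ses c (q \o p : {linear M -> X2}), forall z, c (g' z) = g z
      & forall m, p (c m) = i (p' m)].
Proof.
move=> gp iq; have [g_inj p_surj gpE] := gp; have [i_inj q_surj iqE] := iq.
have [M' [g' [p' [c [gp' cg' pc cov]]]]] := ses_pullback i gp.
exists M', g', p', c; split=> //; split=> [||m].
- apply: inj_lin => m cm0.
  have /gpE [z zE] : p (c m) = 0 by rewrite cm0 linear0.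
  have : p' m = 0 by apply: (inj_eq0 i_inj); rewrite -pc cm0 linear0.
  case: gp' => _ _ gpE' /gpE' [z' z'E]; move: cm0; rewrite -z'E cg'.
  by move=> /(inj_eq0 g_inj) ->; rewrite linear0.
- by move=> x; have [y <-] := q_surj x; have [m <-] := p_surj y; exists m.
split=> [/iqE [x xE]|[z <-]].
  by have [m' [m'E _]] := cov m x (esym xE); exists m'.
by rewrite /= pc (ses0 _ iq).
Qed.

Lemma ext0_middle_l X1 X X2 Y (i : {linear X1 -> X}) (q : {linear X -> X2}) :
  ses i q -> ext0 X1 Y -> ext0 X2 Y -> ext0 X Y.
Proof.
move=> iq e1 e2 Z M g p gp f.
have [M' [g' [p' [c [gp' cp' cg' pc]]]]] := ses_preim gp iq.
have [h1 h1E] := e1 _ _ _ _ gp' f.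
have [h hE] := e2 _ _ _ _ cp' h1.
by exists h => z; rewrite -cg' hE h1E.
Qed.

(** The presentation stands in for the long exact sequence in the second variable: a map into [Y2]
    can be lifted to [Y] once its source is projective. *)
Definition presented X : Prop :=
  exists Z P (k : {linear Z -> P}) (q : {linear P -> X}), projective P /\ ses k q.

Lemma ext0_middle_r X Y1 Y Y2 (i : {linear Y1 -> Y}) (q : {linear Y -> Y2}) :
  presented X -> ses i q -> ext0 X Y1 -> ext0 X Y2 -> ext0 X Y.
Proof.
move=> [Z [P [k [r [projP kr]]]]] [i_inj q_surj iqE] e1 e2.
apply: (ext0_pres projP kr) => f.
have [h2 h2E] := e2 _ _ _ _ kr (q \o f : {linear Z -> Y2}).
have [h hE] := projP _ _ q h2 q_surj.
have [d dE] := lin_sub f (h \o k : {linear Z -> Y}).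
have [|d' d'E] := @corestrict _ _ _ i d i_inj.
  by move=> z; apply/iqE; rewrite dE linearB /= hE h2E subrr.
have [h1 h1E] := e1 _ _ _ _ kr d'.
have [u uE] := lin_add h (i \o h1 : {linear P -> Y}).
by exists u => z; rewrite uE /= h1E d'E dE /= addrC subrK.
Qed.

(** Pull the extension of [X1] back along [b]. As [b a] is the identity, [m] together with [a (p m)]
    is a compatible pair, which maps [M] back into the pullback. *)
Lemma ext0_retract X X1 Y (a : {linear X1 -> X}) (b : {linear X -> X1}) :
  cancel a b -> ext0 X Y -> ext0 X1 Y.
Proof.
move=> abK eX Z M g p gp f.
have [M' [g' [p' [c [gp' cg' pc cov]]]]] := ses_pullback b gp.
have [h hE] := eX _ _ _ _ gp' f.
have [|||t tE] := @lin_of_rel M M' (fun m m' => c m' = m /\ p' m' = a (p m)).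
- by move=> m; apply: cov; rewrite abK.
- move=> m' []; rewrite !linear0 => cm; case: gp' => _ _ gpE' /gpE' [z zE].
  move: cm; rewrite -zE cg'; case: gp => g_inj _ _ /(inj_eq0 g_inj) ->.
  by rewrite linear0.
- by move=> s x y x' y' [cx px] [cx' px']; rewrite !linearP cx cx' px px'.
exists (h \o t : {linear M -> Y}) => z /=; rewrite -hE; congr (h _).
have [ct pt] := tE (g z); apply/eqP; rewrite -subr_eq0; apply/eqP.
case: (gp') => g'_inj _ gpE'.
have /gpE' [z' z'E] : p' (t (g z) - g' z) = 0.
  by rewrite linearB pt (ses0 _ gp) (ses0 _ gp') linear0 subrr.
rewrite -z'E; suff -> : z' = 0 by rewrite linear0.
case: gp => g_inj _ _; apply: (inj_eq0 g_inj).
by rewrite -cg' z'E linearB ct cg' subrr.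
Qed.

Lemma ext0_iso_l X X1 Y : iso X X1 -> ext0 X Y -> ext0 X1 Y.
Proof. by move=> /iso_mapP [f [g [_ gK]]]; exact: ext0_retract gK. Qed.

Lemma ext0_iso_r X Y Y1 : iso Y Y1 -> ext0 X Y -> ext0 X Y1.
Proof.
move=> /iso_mapP [u [v [_ vK]]] eX Z M g p gp f.
have [h hE] := eX _ _ _ _ gp (v \o f : {linear Z -> Y}).
by exists (u \o h : {linear M -> Y1}) => z; rewrite /= hE /= vK.
Qed.

(* Ext^1(X, M) -> Ext^1(X, Z') -> Ext^2(X, Z) = Ext^1(N, Z) is exact. *)
Lemma ext0_cosyzygy N P X Z M (Z' : lmodType K) (k : {linear N -> P}) (q : {linear P -> X})
    (g : {linear Z -> M}) (p : {linear M -> Z'}) :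
  projective P -> ses k q -> ses g p -> ext0 X M -> ext0 N Z -> ext0 X Z'.
Proof.
move=> projP kq gp eXM eNZ; apply: (ext0_pres projP kq) => f.
have [h hE] := ext0_lift f eNZ gp.
have [u uE] := eXM _ _ _ _ kq h.
by exists (p \o u : {linear P -> Z'}) => x; rewrite /= uE hE.
Qed.

(* A class in Ext^1(X, Z) comes from a map X -> Z', since Ext^1(X, Q) = 0; this
   map extends to T because Ext^1(X1, Z') = 0, and the extension lifts to Q
   because Ext^1(T, Z) = 0. *)
Lemma ext0_syzygy X T X1 Z Q (Z' : lmodType K) (i : {linear X -> T}) (q : {linear T -> X1})
    (g : {linear Z -> Q}) (p : {linear Q -> Z'}) :
  ses i q -> ses g p -> ext0 X Q -> ext0 T Z -> ext0 X1 Z' -> ext0 X Z.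
Proof.
move=> iq gp eXQ eTZ eX1 W M j r jr f.
have [h hE] := eXQ _ _ _ _ jr (g \o f : {linear W -> Q}).
have [j_inj r_surj jrE] := jr; have [g_inj p_surj gpE] := gp.
have [|u uE] := @factor_surj _ _ _ r (p \o h : {linear M -> Z'}) r_surj.
  by move=> m /jrE [w <-]; rewrite /= hE /= (ses0 _ gp).
have [v vE] := eX1 _ _ _ _ iq u.
have [t tE] := ext0_lift v eTZ gp.
have [d dE] := lin_sub h (t \o i \o r : {linear M -> Q}).
have [|d' d'E] := @corestrict _ _ _ g d g_inj.
  by move=> m; apply/gpE; rewrite dE linearB /= tE vE uE subrr.
exists d' => w; apply: g_inj; rewrite d'E dE hE /=.
by rewrite (ses0 _ jr) !linear0 addr0.
Qed.

(** This is exactness of Hom(U, Y) -> Ext^1(X2, Y) -> Ext^1(X, Y): the kernel of [c] is a copy [j]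
    of [U], on which [h] must vanish, so [h] descends to [M]. *)
Lemma ext0_quotient U X X2 Y (i : {linear U -> X}) (q : {linear X -> X2}) :
  ses i q -> ext0 X Y -> (forall f : {linear U -> Y}, forall x, f x = 0) ->
  ext0 X2 Y.
Proof.
move=> iq eXY homUY Z M g p gp f.
have [M' [g' [p' [c [gp' cg' pc cov]]]]] := ses_pullback q gp.
have [h hE] := eXY _ _ _ _ gp' f.
have [i_inj q_surj iqE] := iq; have [g_inj p_surj gpE] := gp.
have [|||j jE] := @lin_of_rel U M' (fun x m' => c m' = 0 /\ p' m' = i x).
- by move=> x; apply: cov; rewrite (ses0 _ iq) linear0.
- move=> m' []; rewrite linear0 => cm; case: (gp') => _ _ gpE' /gpE' [z zE].
  by move: cm; rewrite -zE cg' => /(inj_eq0 g_inj) ->; rewrite linear0.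
- by move=> s x y x' y' [cx px] [cx' px']; rewrite !linearP cx cx' px px' scaler0 addr0.
have [||h' h'E] := @factor_surj _ _ _ c h; last first.
- by exists h' => z; rewrite -cg' h'E hE.
- move=> m' cm; have /iqE [x xE] : q (p' m') = 0 by rewrite -pc cm linear0.
  have [cj pj] := jE x; case: gp' => _ _ gpE'.
  have /gpE' [z zE] : p' (m' - j x) = 0 by rewrite linearB pj xE subrr.
  suff -> : m' = j x by have := homUY (h \o j : {linear U -> Y}) x.
  apply/eqP; rewrite -subr_eq0 -zE; apply/eqP.
  suff -> : z = 0 by rewrite linear0.
  by apply: (inj_eq0 g_inj); rewrite -cg' zE linearB cm cj subrr.
by move=> m; have [x xE] := q_surj (p m); have [m' [<- _]] := cov m x (esym xE); exists m'.
Qed.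

Lemma projective_of_ext0 N P X (k : {linear N -> P}) (q : {linear P -> X}) :
  projective P -> ses k q -> ext0 X N -> projective X.
Proof.
move=> projP kq eXN; have [s sE] := ext0_lift (idfun : {linear X -> X}) eXN kq.
move=> M M' g f g_surj; have [h hE] := projP _ _ g (f \o q : {linear P -> M'}) g_surj.
by exists (h \o s : {linear X -> M}) => x; rewrite /= hE /= sE.
Qed.

Lemma projective_iso P Q : iso P Q -> projective P -> projective Q.
Proof.
move=> /iso_mapP [u [v [_ vK]]] projP M N g f g_surj.
have [h hE] := projP _ _ g (f \o u : {linear P -> N}) g_surj.
by exists (h \o v : {linear Q -> M}) => x; rewrite /= hE /= vK.
Qed.

Lemma projective_prod P Q : projective P -> projective Q -> projective (P * Q)%type.
Proof.
move=> projP projQ M N g f g_surj.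
have [i [p [_ iE _]]] := ses_prod P Q.
have [o oE] := lin_zero Q P; have [j jE] := pair_lin o (idfun : {linear Q -> Q}).
have [h hE] := projP _ _ g (f \o i : {linear P -> N}) g_surj.
have [h' h'E] := projQ _ _ g (f \o j : {linear Q -> N}) g_surj.
have [u uE] := lin_add (h \o fst : {linear (P * Q)%type -> M})
                       (h' \o snd : {linear (P * Q)%type -> M}).
exists u => x; rewrite uE linearD /= hE h'E /= -linearD; congr (f _).
by rewrite iE jE oE /= -pair_split.
Qed.

Lemma injective_prod P Q :
  injective_module P -> injective_module Q -> injective_module (P * Q)%type.
Proof.
move=> injP injQ M N g f g_inj.
have [h hE] := injP _ _ g (fst \o f : {linear M -> P}) g_inj.
have [h' h'E] := injQ _ _ g (snd \o f : {linear M -> Q}) g_inj.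
have [u uE] := pair_lin h h'.
by exists u => x; rewrite uE hE h'E /= -surjective_pairing.
Qed.

Lemma injective_zero Z : is_zero Z -> injective_module Z.
Proof.
move=> Z0 M N g f _; have [h hE] := lin_zero N Z.
by exists h => x; rewrite hE [RHS]Z0.
Qed.

Lemma projective_zero Z : is_zero Z -> projective Z.
Proof.
move=> Z0 M N g f _; have [h hE] := lin_zero Z M.
by exists h => x; rewrite hE linear0 (Z0 x) linear0.
Qed.

Lemma ses_comp Y M X (E X' : lmodType K) (g : {linear Y -> M}) (p : {linear M -> X})
    (g' : {linear M -> E}) (p' : {linear E -> X'}) : ses g p -> ses g' p' ->
  exists (W : lmodType K) (q : {linear E -> W}) (i : {linear X -> W}) (r : {linear W -> X'}),
    ses (g' \o g : {linear Y -> E}) q /\ ses i r.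
Proof.
move=> gp gp'; have [g_inj p_surj gpE] := gp; have [g'_inj p'_surj gpE'] := gp'.
have [W [q gq]] := ses_coker (g := g' \o g) (inj_comp g'_inj g_inj).
have [_ q_surj gqE] := gq.
have [|i iE] := @factor_surj _ _ _ p (q \o g' : {linear M -> W}) p_surj.
  by move=> m /gpE [y <-]; apply/gqE; exists y.
have [|r rE] := @factor_surj _ _ _ q p' q_surj.
  by move=> x /gqE [y <-]; exact: ses0 gp'.
exists W, q, i, r; split=> //; split=> [|x|w].
- apply: inj_lin => x; have [m <-] := p_surj x; rewrite iE => /gqE [y /g'_inj <-].
  exact: ses0 gp.
- by have [y <-] := p'_surj x; exists (q y).
have [y <-] := q_surj w; rewrite rE gpE'; split=> [[m <-]|[x]].
  by exists (p m); rewrite iE.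
have [m <-] := p_surj x; rewrite iE /= => qm.
have /gqE [z zE] : q (y - g' m) = 0 by rewrite linearB qm subrr.
by exists (m + g z); rewrite linearD; move: zE => /= ->; rewrite addrC subrK.
Qed.

End LinearMaps.

(** * Filtrations and resolutions *)

Section Filtrations.
Context {K : pzRingType}.
Implicit Types V W X Y Z M N P Q T U : lmodType K.
Implicit Types Theta C : lmodType K -> Prop.

Lemma is_zero_iso V W : iso V W -> is_zero V -> is_zero W.
Proof. by move=> /iso_mapP [f [g [fK gK]]] V0 w; rewrite -[w]gK (V0 (g w)) linear0. Qed.

Lemma ex_zero_module : exists Z : lmodType K, is_zero Z.
Proof.
have [Z [g [g_inj gE]]] := ex_sub (closed_zero K^o).
by exists Z => z; apply: (inj_eq0 g_inj); apply/gE; exists z.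
Qed.

(** A filtration grown from below, one layer at a time and up to isomorphism; it supports induction
    without carrying a chain of submodules of one module. *)
Inductive filt Theta : lmodType K -> Prop :=
| Filt0 M of is_zero M : filt Theta M
| FiltS Z M X (g : {linear Z -> M}) (p : {linear M -> X}) of
    ses g p & filt Theta Z & Theta X : filt Theta M.

Lemma ses_iso_m Z M M1 X (g : {linear Z -> M}) (p : {linear M -> X}) : ses g p ->
  iso M M1 -> exists (g1 : {linear Z -> M1}) (p1 : {linear M1 -> X}), ses g1 p1.
Proof.
move=> [g_inj p_surj gpE] /iso_mapP [u [v [uK vK]]].
exists (u \o g), (p \o v); split=> [|x|m].
- exact: inj_comp (can_inj uK) g_inj.
- by have [m <-] := p_surj x; exists (u m); rewrite /= uK.
rewrite /= gpE; split=> [[z zE]|[z <-]]; exists z; last by rewrite uK.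
by rewrite zE vK.
Qed.

Lemma ses_zero_l M : exists Z (g : {linear Z -> M}), ses g (idfun : {linear M -> M}).
Proof.
have [Z Z0] := ex_zero_module; have [g gE] := lin_zero Z M.
exists Z, g; split=> [z z' _|x|x]; first by rewrite (Z0 z) (Z0 z').
  by exists x.
by split=> [/= ->|[z <-]]; [exists 0; rewrite gE|rewrite gE].
Qed.

Lemma ses_zero_r M : exists Z (p : {linear M -> Z}), ses (idfun : {linear M -> M}) p /\ is_zero Z.
Proof.
have [Z Z0] := ex_zero_module; have [p pE] := lin_zero M Z.
exists Z, p; split=> //; split=> // [z|x]; first by exists 0; rewrite (Z0 z) pE.
by split=> // _; exists x.
Qed.

Lemma filt_iso Theta M M1 : iso M M1 -> filt Theta M -> filt Theta M1.
Proof.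
move=> isoM FM; case: FM isoM => {M} [M M0|Z M X g p gp FZ TX] isoM.
  by apply: Filt0; exact: is_zero_iso isoM M0.
by have [g1 [p1 gp1]] := ses_iso_m gp isoM; exact: FiltS gp1 FZ TX.
Qed.

Lemma filt_one Theta M : Theta M -> filt Theta M.
Proof.
move=> TM; have [Z [g gp]] := ses_zero_l M.
apply: (FiltS gp _ TM); apply: Filt0 => z.
by case: gp => g_inj _ E; apply: (inj_eq0 g_inj); apply/E; exists z.
Qed.

Lemma filt_ses Theta Z M X (g : {linear Z -> M}) (p : {linear M -> X}) :
  ses g p -> filt Theta Z -> filt Theta X -> filt Theta M.
Proof.
move=> gp FZ FX; elim: FX M g p gp => {X} [X X0|X1 X X2 i q iq _ IH TX2] M g p gp.
  by apply: filt_iso FZ; apply: (isoE (f := g)); [case: gp | exact: ses_iso1 gp X0].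
have [M' [g' [p' [c [gp' cp _ _]]]]] := ses_preim gp iq.
by apply: FiltS cp (IH _ _ _ gp') TX2.
Qed.

Lemma filt_mono Theta Theta' M : (forall X, Theta X -> Theta' X) ->
  filt Theta M -> filt Theta' M.
Proof.
move=> sub; elim=> {M} [M M0|Z M X g p gp _ FZ /sub TX]; first exact: Filt0.
exact: FiltS gp FZ TX.
Qed.

Lemma factorP M (U W : submodule M) X : iso (factor U W) X <->
  exists p : {linear submod W -> X}, surj p /\ forall x, p x = 0 <-> val x \in U.
Proof.
have [q [q_surj qE]] := quotmod_proj (restrict_pred U W).
split=> [/iso_mapP [u [v [uK vK]]]|[p [p_surj pE]]].
  exists (u \o q); split=> [x|x].
    by have [y yE] := q_surj (v x); exists y; rewrite /= yE vK.
  have -> : (val x \in U) = (x \in restrict_pred U W) by [].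
  by rewrite -qE /=; split=> [/(inj_eq0 (can_inj uK))|->]; rewrite ?linear0.
have [|h hE] := @factor_surj _ _ _ _ q p q_surj.
  by move=> x /qE /pE.
apply: (isoE (f := h)) => [|y]; last by have [x <-] := p_surj y; exists (q x); rewrite hE.
by apply: inj_lin => x; have [y <-] := q_surj x; rewrite hE => /pE /qE.
Qed.

Lemma submod_incl M (U W : submodule M) : submodule_le U W ->
  exists i : {linear submod U -> submod W}, injective i /\ forall x, val (i x) = val x.
Proof.
move=> UW; have [gU gUE] := submod_emb U; have [gW gWE] := submod_emb W.
have gW_inj : injective gW by move=> x y; rewrite !gWE => /val_inj.
have [|i iE] := @corestrict _ _ _ _ gW gU gW_inj.
  by move=> x; exists (exist _ (val x) (UW _ (valP x))); rewrite gWE gUE.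
have {}iE x : val (i x) = val x by rewrite -gUE -iE gWE.
by exists i; split=> // x y /(congr1 val); rewrite !iE => /val_inj.
Qed.

Lemma submod_full M (U : submodule M) : (forall x, x \in U) -> iso (submod U) M.
Proof.
move=> Uf; have [g gE] := submod_emb U.
apply: (isoE (f := g)) => [x y|x]; first by rewrite !gE => /val_inj.
by exists (exist _ x (Uf x)); rewrite gE.
Qed.

Lemma filtered_filt Theta M : filtered Theta M -> filt Theta M.
Proof.
case=> l [N [[N0 Nl Nle] NT]].
apply: filt_iso (submod_full Nl) _.
have: (l <= l)%N by [].
elim: {-2}l => [|k IH] kl.
  by apply: Filt0 => x; apply: val_inj; exact: N0 (valP x).
have [X TX /factorP [p [p_surj pE]]] := NT k kl.
have [i [i_inj iE]] := submod_incl (Nle k kl).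
apply: FiltS (IH (ltnW kl)) TX; split; [exact: i_inj | exact: p_surj |].
move=> x; rewrite pE; split=> [xN|[z <-]]; last by rewrite iE; exact: valP.
by exists (exist _ (val x) xN); apply: val_inj; rewrite iE.
Qed.

Lemma filt_filtered Theta M : filt Theta M -> filtered Theta M.
Proof.
elim=> {M} [M M0|Z M X g p gp _ [l [N [[N0 Nl Nle] NT]]] TX].
  have [U UE] := ex_submodule (closed_zero M).
  exists 0%N, (fun=> U); split=> //; split=> [x Ux|x|//]; apply/UE => //; exact: M0.
have [g_inj p_surj gpE] := gp.
(* The chain of [Z] is pushed into [M], and all of [M] is added as step [l.+1]. *)
have [k|N' N'E] := @choice _ _ (fun k (U : submodule M) => forall x, x \in U <->
    if (k <= l)%N then exists2 z, z \in N k & g z = x else True).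
  have [kl|kl] := leqP k l; last exact: ex_submodule (closed_all M).
  exact: ex_submodule (closed_im g (closed_submodule (N k))).
exists l.+1, N'; split.
  split=> [x|x|k]; first by move/N'E => [z /N0 -> <-]; rewrite linear0.
    by apply/N'E; rewrite ltnn.
  rewrite ltnS => kl x /N'E; rewrite kl => -[z zN zE]; apply/N'E.
  by case: ifP => // kl'; exists z => //; exact: Nle.
move=> k; rewrite ltnS leq_eqVlt => /orP [/eqP ->|kl]; last first.
  have [X1 TX1 /factorP [q [q_surj qE]]] := NT k kl.
  exists X1 => //; apply/factorP.
  have [j jE] := submod_emb (N k.+1); have [j' j'E] := submod_emb (N' k.+1).
  have gj_inj : injective (g \o j) by move=> x y /= /g_inj; rewrite !jE => /val_inj.
  have [|h hE] := @corestrict _ _ _ _ (g \o j : {linear submod (N k.+1) -> M}) j' gj_inj.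
    move=> x; have /N'E := valP x; rewrite kl => -[z zN zE].
    by exists (exist _ z zN); rewrite /= jE j'E.
  have {}hE x : g (val (h x)) = val x by rewrite -j'E -hE /= jE.
  exists (q \o h); split=> [y|x].
    have [x xE] := q_surj y.
    have xN : g (val x) \in N' k.+1.
      by apply/N'E; rewrite kl; exists (val x) => //; exact: valP.
    exists (exist _ (g (val x)) xN); rewrite -xE /=; congr (q _); apply: val_inj; apply: g_inj.
    by rewrite hE.
  rewrite /= qE; split=> [hx|/N'E].
    by apply/N'E; rewrite (ltnW kl); exists (val (h x)).
  by rewrite (ltnW kl) => -[z zN]; rewrite -hE => /g_inj <-.
exists X => //; apply/factorP; have [j jE] := submod_emb (N' l.+1).
exists (p \o j); split=> [x|x].
  have [m mE] := p_surj x; have mN : m \in N' l.+1 by apply/N'E; rewrite ltnn.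
  by exists (exist _ m mN); rewrite /= jE.
rewrite /= jE gpE; split=> [[z zE]|/N'E]; first by apply/N'E; rewrite leqnn; exists z.
by rewrite leqnn => -[z _ zE]; exists z.
Qed.

Lemma filteredE Theta M : filtered Theta M <-> filt Theta M.
Proof. by split; [exact: filtered_filt | exact: filt_filtered]. Qed.

Lemma coresolution0 C X : C X -> coresolution C X 0.
Proof.
move=> CX; have [Z Z0] := ex_zero_module.
pose M k := if k is 0 then X else Z.
have o k : {linear M k -> M k.+1} := sval (cid (lin_zero (M k) (M k.+1))).
have Mz k (x : M k.+1) : x = 0 by exact: Z0.
exists M, (idfun : {linear X -> X}), o; split=> // [x|k x|k|[]//].
- by split=> [_|_]; [exists x | exact: Mz].
- by split=> [_|_]; [exists 0; rewrite linear0 [RHS]Mz | exact: Mz].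
- by rewrite leqn0 => /eqP ->.
Qed.

Lemma coresolutionS C X M0 X1 d (g : {linear X -> M0}) (p : {linear M0 -> X1}) :
  ses g p -> C M0 -> coresolution C X1 d -> coresolution C X d.+1.
Proof.
move=> [g_inj p_surj gpE] CM0 [M [eta [del [eta_inj e0 eS CM Mz]]]].
pose M' k := if k is k'.+1 then M k' else M0.
pose del' k : {linear M' k -> M' k.+1} :=
  if k is k'.+1 then del k' else (eta \o p : {linear M0 -> M 0%N}).
exists M', g, del'; split=> //.
- by move=> x; rewrite -gpE /=; split=> [/(inj_eq0 eta_inj)|->]; rewrite ?linear0.
- case=> [|k] x; last exact: eS.
  rewrite /= e0; split=> [[y <-]|[y <-]]; last by exists (p y).
  by have [m <-] := p_surj y; exists m.
- by case=> // k; exact: CM.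
- by case=> // k; exact: Mz.
Qed.

Lemma coresolution0_inv C X : coresolution C X 0 -> exists2 M, C M & iso X M.
Proof.
case=> M [eta [del [eta_inj e0 eS CM Mz]]]; exists (M 0%N); first exact: CM.
by apply: (isoE (f := eta)) => // x; apply/e0/(Mz 1%N).
Qed.

Lemma coresolutionS_inv C X d : coresolution C X d.+1 ->
  exists M0 X1 (g : {linear X -> M0}) (p : {linear M0 -> X1}),
    [/\ ses g p, C M0 & coresolution C X1 d].
Proof.
case=> M [eta [del [eta_inj e0 eS CM Mz]]].
have [X1 [p gp]] := ses_coker eta_inj; have [_ p_surj gpE] := gp.
have [|eta1 eta1E] := @factor_surj _ _ _ _ p (del 0%N) p_surj.
  by move=> m /gpE /e0.
exists (M 0%N), X1, eta, p; split=> //; first exact: CM.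
exists (fun k => M k.+1), eta1, (fun k => del k.+1); split=> [|x|k x|k kd|k kd].
- apply: inj_lin => x; have [m <-] := p_surj x.
  by rewrite eta1E => /e0 /gpE.
- rewrite eS; split=> [[y <-]|[y <-]]; first by exists (p y); rewrite eta1E.
  by have [m <-] := p_surj y; exists m; rewrite eta1E.
- exact: eS.
- exact: CM.
- exact: Mz.
Qed.

(** The same complex serves: its zero modules beyond [d] now count as terms in [C]. *)
Lemma coresolution_mono C X d d' : (forall Z, is_zero Z -> C Z) ->
  (d <= d')%N -> coresolution C X d -> coresolution C X d'.
Proof.
move=> C0 dd [M [eta [del [eta_inj e0 eS CM Mz]]]].
exists M, eta, del; split=> // k kd; last by apply: Mz; exact: leq_ltn_trans kd.
by have [/CM|/Mz/C0] := leqP k d.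
Qed.

Lemma projective_resolution0 X : projective X -> projective_resolution X 0.
Proof.
move=> projX; have [Z Z0] := ex_zero_module.
pose P k := if k is 0 then X else Z.
have o k : {linear P k.+1 -> P k} := sval (cid (lin_zero (P k.+1) (P k))).
have Pz k (x : P k.+1) : x = 0 by exact: Z0.
exists P, (idfun : {linear X -> X}), o; split=> // [x|x|k x|k|[]//].
- by exists x.
- split=> [/= ->|[y <-]]; first by exists 0; rewrite linear0.
  by rewrite (Pz _ y) linear0.
- split=> [_|[y <-]]; first by exists 0; rewrite (Pz _ x) linear0.
  by rewrite (Pz _ y) !linear0.
- by rewrite leqn0 => /eqP ->.
Qed.

Lemma projective_resolutionS N P0 X d (k : {linear N -> P0}) (q : {linear P0 -> X}) :
  ses k q -> projective P0 -> projective_resolution N d ->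
  projective_resolution X d.+1.
Proof.
move=> [k_inj q_surj kqE] projP0 [P [eps [del [eps_surj e0 eS projP Pz]]]].
pose P' j := if j is j'.+1 then P j' else P0.
pose del' j : {linear P' j.+1 -> P' j} :=
  if j is j'.+1 then del j' else (k \o eps : {linear P 0%N -> P0}).
exists P', q, del'; split=> //.
- move=> x; rewrite kqE /=; split=> [[z <-]|[z <-]]; last by exists (eps z).
  by have [y <-] := eps_surj z; exists y.
- case=> [|j] x; last exact: eS.
  by rewrite /= -e0; split=> [/(inj_eq0 k_inj)|->]; rewrite ?linear0.
- by case=> // j; exact: projP.
- by case=> // j; exact: Pz.
Qed.

Lemma projective_resolution0_inv X : projective_resolution X 0 -> projective X.
Proof.
case=> P [eps [del [eps_surj e0 eS projP Pz]]].
apply: projective_iso (projP 0%N _) => //.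
apply: (isoE (f := eps)) => //; apply: inj_lin => x /e0 [y <-].
by rewrite (Pz 1%N _ y) ?linear0.
Qed.

Lemma projective_resolutionS_inv X d : projective_resolution X d.+1 ->
  exists N P0 (k : {linear N -> P0}) (q : {linear P0 -> X}),
    [/\ ses k q, projective P0 & projective_resolution N d].
Proof.
case=> P [eps [del [eps_surj e0 eS projP Pz]]].
have [N [k kq]] := ses_ker eps_surj; have [k_inj _ kqE] := kq.
have [|eps1 eps1E] := @corestrict _ _ _ _ k (del 0%N) k_inj.
  by move=> x; apply/kqE/e0; exists x.
exists N, (P 0%N), k, eps; split=> //; first exact: projP.
exists (fun j => P j.+1), eps1, (fun j => del j.+1); split=> [z|x|j x|j jd|j jd].
- have /e0 [y yE] : eps (k z) = 0 by apply/kqE; exists z.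
  by exists y; apply: k_inj; rewrite eps1E.
- by rewrite -eS -eps1E; split=> [->|/(inj_eq0 k_inj)]; rewrite ?linear0.
- exact: eS.
- exact: projP.
- exact: Pz.
Qed.

Lemma ext0_filt_l Theta X Y : (forall D, Theta D -> ext0 D Y) -> filt Theta X -> ext0 X Y.
Proof.
move=> eT; elim=> {X} [X X0|Z X D g p gp _ eZ TD].
  by apply: ext0_proj; exact: projective_zero.
exact: ext0_middle_l gp eZ (eT _ TD).
Qed.

Lemma ext0_filt_r Theta X Y : presented X ->
  (forall D, Theta D -> ext0 X D) -> filt Theta Y -> ext0 X Y.
Proof.
move=> presX eT; elim=> {Y} [Y Y0|Z Y D g p gp _ eZ TD].
  by apply: ext0_inj; exact: injective_zero.
exact: ext0_middle_r gp eZ (eT _ TD).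
Qed.

End Filtrations.

(** * Chain conditions *)

Section ChainConditions.
Context {K : pzRingType}.
Implicit Types V W X Y Z M N : lmodType K.

Definition incl (b : bool) (T : Type) (P Q : T -> Prop) : Prop :=
  if b then forall x, P x -> Q x else forall x, Q x -> P x.

(* The ascending chain condition on submodules for [b = true], the descending
   one for [b = false]. *)
Definition extremal (b : bool) V : Prop :=
  forall F : (V -> Prop) -> Prop, (forall P, F P -> lin_closed P) -> (exists P, F P) ->
  exists2 P, F P & forall Q, F Q -> incl b P Q -> forall x, P x <-> Q x.

Definition img V W (f : V -> W) (P : V -> Prop) : W -> Prop :=
  fun y => exists2 x, P x & f x = y.

Lemma incl_img b V W (f : V -> W) (P Q : V -> Prop) :
  incl b P Q -> incl b (img f P) (img f Q).
Proof. by case: b => PQ y [x Px <-]; exists x => //; exact: PQ. Qed.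

Lemma extremal_inj b V W (f : {linear V -> W}) :
  injective f -> extremal b W -> extremal b V.
Proof.
move=> f_inj eW F Fc [P0 FP0].
have [||_ [P FP ->] Pmax] := eW (fun R => exists2 P, F P & R = img f P).
- by move=> _ [P /Fc cP ->]; exact: closed_im.
- by exists (img f P0), P0.
exists P => // Q FQ /(incl_img f) PQ x.
have := Pmax (img f Q) _ PQ (f x).
case=> [|PQx QPx]; first by exists Q.
split=> [Px|Qx]; first by have [|y Qy /f_inj <-] := PQx; first by exists x.
by have [|y Py /f_inj <-] := QPx; first by exists x.
Qed.

Lemma extremal_surj b V W (f : {linear V -> W}) :
  surj f -> extremal b V -> extremal b W.
Proof.
move=> f_surj eV F Fc [P0 FP0].
have [||_ [P FP ->] Pmax] := eV (fun R => exists2 P, F P & R = (fun x => P (f x))).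
- by move=> _ [P /Fc cP ->]; exact: closed_preim.
- by exists (fun x => P0 (f x)), P0.
exists P => // Q FQ PQ y; have [x <-] := f_surj y.
apply: (Pmax (fun x => Q (f x))); first by exists Q.
by move: PQ; case: (b) => PQ z; exact: PQ.
Qed.

Lemma extremal_iso b V W : iso V W -> extremal b V -> extremal b W.
Proof.
move=> /iso_mapP [f [g [fK gK]]]; apply: (extremal_surj (f := f)) => y.
by exists (g y).
Qed.

(** Choose a member of [F] with extremal image in [X], then, among those with this image, one with
    extremal intersection with [Z]. *)
Lemma extremal_ses b Z M X (g : {linear Z -> M}) (p : {linear M -> X}) :
  ses g p -> extremal b Z -> extremal b X -> extremal b M.
Proof.
move=> gp eZ eX F Fc [P0 FP0]; have [g_inj p_surj gpE] := gp.
have [||_ [P1 FP1 ->] P1max] := eX (fun R => exists2 P, F P & R = img p P).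
- by move=> _ [P /Fc cP ->]; exact: closed_im.
- by exists (img p P0), P0.
have [||_ [P [FP PP1 ->]] Pmax] := eZ (fun R => exists P,
    [/\ F P, forall x, img p P x <-> img p P1 x & R = (fun z => P (g z))]).
- by move=> _ [P [/Fc cP _ ->]]; exact: closed_preim.
- by exists (fun z => P1 (g z)), P1.
exists P => // Q FQ PQ.
have P1Q x : img p P1 x <-> img p Q x.
  apply: P1max; first by exists Q.
  by have := incl_img p PQ; case: (b) => PQ' y; [move=> /PP1 /PQ' | move=> /PQ' /PP1].
have PQz z : P (g z) <-> Q (g z).
  apply: (Pmax (fun z => Q (g z))).
    by exists Q; split=> // x; split=> /P1Q.
  by move: PQ; case: (b) => PQ y; exact: PQ.
(* Modular law: nested submodules with equal images in [X] and equal intersections with [Z]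
   coincide. *)
have sub (P' Q' : M -> Prop) : lin_closed P' -> lin_closed Q' -> (forall x, P' x -> Q' x) ->
    (forall x, img p Q' x -> img p P' x) -> (forall z, Q' (g z) -> P' (g z)) ->
    forall x, Q' x -> P' x.
  move=> cP cQ P'Q' Q'P' Q'P'z x Qx.
  have [|y Py pxy] := Q'P' (p x); first by exists x.
  have /gpE [z zE] : p (x - y) = 0 by rewrite linearB pxy subrr.
  rewrite -(subrK y x) -zE; apply: closedD => //; apply: Q'P'z; rewrite zE.
  by apply: closedB => //; exact: P'Q'.
have {}P1Q x : img p P x <-> img p Q x by rewrite PP1 P1Q.
have [cP cQ] := (Fc _ FP, Fc _ FQ).
move: PQ; case: (b) => /= PQ x; split; try exact: PQ; apply: sub => //.
- by move=> y /P1Q.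
- by move=> z /PQz.
- by move=> y /P1Q.
- by move=> z /PQz.
Qed.

Lemma extremal_simple b V : (forall P : V -> Prop, lin_closed P ->
  (forall x, P x -> x = 0) \/ (forall x, P x)) -> extremal b V.
Proof.
move=> simpV F Fc [P0 FP0].
have triv P : F P -> (forall x, P x <-> x = 0) \/ (forall x, P x).
  move=> /Fc cP; have [P0'|] := simpV P cP; [left=> x|by right].
  by split=> [/P0'|->] //; case: cP.
case: b.
  have [[P [FP Pall]]|noall] := pselect (exists P, F P /\ forall x, P x).
    by exists P => // Q _ PQ x; split=> // _; exact/PQ.
  exists P0 => // Q FQ PQ x; have [Q0|Qall] := triv Q FQ; last by case: noall; exists Q.
  have [P00|Pall] := triv P0 FP0; last by case: noall; exists P0.
  by rewrite Q0 P00.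
have [[P [FP P00]]|nozero] := pselect (exists P, F P /\ forall x, P x <-> x = 0).
  exists P => // Q FQ QP x; split=> [|Qx]; last exact: QP.
  by move/P00 => ->; case: (Fc Q FQ).
exists P0 => // Q FQ PQ x; have [Q0|Qall] := triv Q FQ; first by case: nozero; exists Q.
by have [P00|Pall] := triv P0 FP0; first by case: nozero; exists P0.
Qed.

Lemma extremal_zero b V : is_zero V -> extremal b V.
Proof. by move=> V0; apply: extremal_simple => P _; left=> x _; exact: V0. Qed.

Lemma im_module V W (f : {linear V -> W}) : exists Z (g : {linear Z -> W}) (p : {linear V -> Z}),
  [/\ injective g, surj p & forall x, g (p x) = f x].
Proof.
have [Z [g [g_inj gE]]] := ex_sub (closed_range f).
have [|p pE] := corestrict (g := g) (h := f) g_inj.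
  by move=> x; apply/gE; exists x.
exists Z, g, p; split=> // z; have /gE [x xE] : exists z', g z' = g z by exists z.
by exists x; apply: g_inj; rewrite pE.
Qed.

Lemma extremal_sum b m V W (f : 'I_m -> {linear W -> V}) :
  (forall v, exists w : 'I_m -> W, v = \sum_(i < m) f i (w i)) ->
  extremal b W -> extremal b V.
Proof.
move=> fV eW; elim: m V f fV => [|m IH] V f fV.
  by apply: extremal_zero => v; have [w ->] := fV v; rewrite big_ord0.
have [Z [g [p [g_inj p_surj pE]]]] := im_module (f ord0).
have [X [q gq]] := ses_coker g_inj.
apply: (extremal_ses gq); first exact: extremal_surj p_surj eW.
apply: (IH _ (fun i => q \o f (lift ord0 i) : {linear W -> X})) => x.
have [_ q_surj _] := gq; have [v <-] := q_surj x; have [w ->] := fV v.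
exists (fun i => w (lift ord0 i)).
by rewrite big_ord_recl linearD -pE (ses0 _ gq) add0r linear_sum.
Qed.

Lemma scale_lin V (v : V) : exists f : {linear K^o -> V}, forall a, f a = (a : K) *: v.
Proof. by apply: (ex_lin (f := fun a : K^o => (a : K) *: v)) => a x y; rewrite scalerDl scalerA. Qed.

Lemma fin_gen_extremal b V : fin_gen V -> extremal b K^o -> extremal b V.
Proof.
move=> [m [g gV]] eK; have [f fE] := choice (fun i => scale_lin (g i)).
apply: (extremal_sum (f := f)) eK => v; have [c ->] := gV v.
by exists c; apply: eq_bigr => i _; rewrite fE.
Qed.

(** A maximal finitely generated submodule absorbs any further generator [v], hence is
    everything. *)
Lemma extremal_fin_gen V : extremal true V -> fin_gen V.
Proof.
move=> eV.
pose span m (g : 'I_m -> V) v := exists c : 'I_m -> K, v = \sum_(i < m) c i *: g i.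
have [||_ [m [g ->]] gmax] := eV (fun P => exists m (g : 'I_m -> V), P = span m g).
- move=> _ [m [g ->]]; split.
    by exists (fun=> 0); rewrite big1 // => i _; rewrite scale0r.
  move=> a _ _ [c ->] [c' ->]; exists (fun i => a * c i + c' i).
  rewrite scaler_sumr -big_split; apply: eq_bigr => i _.
  by rewrite scalerDl scalerA.
- by exists (span 0%N (fun=> 0)), 0%N, (fun=> 0).
exists m, g => v.
pose g' (i : 'I_m.+1) := oapp g v (unlift ord0 i).
apply/(gmax (span m.+1 g')); first by exists m.+1, g'.
  move=> _ [c ->]; exists (fun i => oapp c 0 (unlift ord0 i)).
  rewrite big_ord_recl unlift_none scale0r add0r.
  by apply: eq_bigr => i _; rewrite /g' liftK.
exists (fun i => (i == ord0)%:R).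
rewrite big_ord_recl /g' unlift_none scale1r big1 ?addr0 // => i _.
by rewrite scale0r.
Qed.

(** Finite length, expressed as both chain conditions; each closure property then needs one proof,
    uniform in [b]. *)
Definition fin V : Prop := forall b, extremal b V.

Lemma fin_inj V W (f : {linear V -> W}) : injective f -> fin W -> fin V.
Proof. by move=> f_inj finW b; exact: extremal_inj f_inj (finW b). Qed.

Lemma fin_surj V W (f : {linear V -> W}) : surj f -> fin V -> fin W.
Proof. by move=> f_surj finV b; exact: extremal_surj f_surj (finV b). Qed.

Lemma fin_iso V W : iso V W -> fin V -> fin W.
Proof. by move=> VW finV b; exact: extremal_iso VW (finV b). Qed.

Lemma fin_ses Z M X (g : {linear Z -> M}) (p : {linear M -> X}) :
  ses g p -> fin Z -> fin X -> fin M.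
Proof. by move=> gp finZ finX b; exact: extremal_ses gp (finZ b) (finX b). Qed.

Lemma fin_zero V : is_zero V -> fin V.
Proof. by move=> V0 b; exact: extremal_zero. Qed.

Lemma fin_prod V W : fin V -> fin W -> fin (V * W)%type.
Proof. by move=> finV finW; have [g [p [gp _ _]]] := ses_prod V W; exact: fin_ses gp finV finW. Qed.

Lemma fin_filt Theta M : (forall X, Theta X -> fin X) -> filt Theta M -> fin M.
Proof.
move=> finT; elim=> {M} [M|Z M X g p gp _ finZ TX]; first exact: fin_zero.
exact: fin_ses gp finZ (finT _ TX).
Qed.

Lemma fin_gen_fin V : fin V -> fin_gen V.
Proof. by move=> /(_ true); exact: extremal_fin_gen. Qed.

(** Noetherian induction: among the submodules whose quotient violates [Q], a maximal one would have
    a quotient all of whose proper quotients satisfy [Q]. *)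
Lemma quotient_ind (Q : lmodType K -> Prop) :
  (forall M, fin M ->
    (forall X (p : {linear M -> X}), surj p -> ~ injective p -> Q X) -> Q M) ->
  forall M, fin M -> Q M.
Proof.
move=> IH M finM.
suff main (P : M -> Prop) : lin_closed P ->
    forall X (p : {linear M -> X}), surj p -> (forall x, p x = 0 <-> P x) -> Q X.
  apply: (main (fun x => x = 0) (closed_zero M) M (idfun : {linear M -> M})) => //.
  by move=> y; exists y.
apply: contrapT => nmain; move: P nmain => P1 nmain.
pose bad (P : M -> Prop) := lin_closed P /\ exists X (p : {linear M -> X}),
  [/\ surj p, forall x, p x = 0 <-> P x & ~ Q X].
have [||P [cP [X [p [p_surj pE nQ]]]] Pmax] := finM true bad.
- by move=> R [].
- apply: contrapT => nbad; apply: nmain => cP X p p_surj pE.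
  by apply: contrapT => nQ; apply: nbad; exists P1; split=> //; exists X, p.
apply: nQ; apply: IH; first exact: fin_surj p_surj finM.
move=> X' q q_surj q_ninj; apply: contrapT => nQ; apply: q_ninj.
have bad' : bad (fun x => q (p x) = 0).
  split; first exact: (closed_preim (q \o p : {linear M -> X'}) (closed_zero X')).
  exists X', (q \o p); split=> // x.
  by have [y <-] := q_surj x; have [m <-] := p_surj y; exists m.
apply: inj_lin => x; have [m <-] := p_surj x => qpm.
apply/pE/(Pmax _ bad') => //= y /pE ->; exact: linear0.
Qed.

Lemma simple_moduleP V : simple_module V <-> ~ is_zero V /\
  forall P : V -> Prop, lin_closed P -> (forall x, P x -> x = 0) \/ (forall x, P x).
Proof.
split=> -[V0 simpV]; split=> //.
  move=> P /ex_submodule [U UE].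
  by have [U0|Uall] := simpV U; [left=> x /UE /U0|right=> x; apply/UE].
by move=> U; have [|] := simpV _ (closed_submodule U); [left|right].
Qed.

Lemma simple_iso V W : iso V W -> simple_module V -> simple_module W.
Proof.
move=> VW /simple_moduleP [V0 simpV]; apply/simple_moduleP; split.
  by move=> W0; apply: V0; exact: is_zero_iso (iso_sym VW) W0.
have [f [g [fK gK]]] := iso_mapP VW.
move=> P cP; have [P0|Pall] := simpV _ (closed_preim f cP).
  by left=> x Px; rewrite -[x]gK (P0 (g x)) ?gK ?linear0.
by right=> x; rewrite -[x]gK.
Qed.

Lemma nonzero_simple_sub V : extremal false V -> ~ is_zero V ->
  exists Z (g : {linear Z -> V}), injective g /\ simple_module Z.
Proof.
move=> eV V0.
have [||P [cP [x0 Px0 x00]] Pmin] :=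
    eV (fun P => lin_closed P /\ exists2 x, P x & x != 0).
- by move=> P [].
- exists (fun=> True); split=> //; apply: contrapT => nx; apply: V0 => v.
  by apply/eqP; apply: contrapT => /negP v0; apply: nx; exists v.
have [Z [g [g_inj gE]]] := ex_sub cP.
exists Z, g; split=> //; apply/simple_moduleP; split.
  by move=> Z0; have /gE [z zE] := Px0; case/eqP: x00; rewrite -zE (Z0 z) linear0.
move=> R cR; have [|nR] := pselect (forall x, R x -> x = 0); [by left|right].
have Rmin x : P x <-> img g R x.
  apply: Pmin; last by move=> _ [z _ <-]; apply/gE; exists z.
  split; first exact: closed_im.
  apply: contrapT => nx; apply: nR => z Rz; apply: (inj_eq0 g_inj).
  apply/eqP; apply: contrapT => /negP gz0; apply: nx; exists (g z) => //.
  by exists z.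
move=> z; have /Rmin [z' Rz' /g_inj <-] //: P (g z) by apply/gE; exists z.
Qed.

End ChainConditions.

(** * Hopkins' theorem for the commutative base ring *)

Section Hopkins.
Context {R : comNzRingType}.
Implicit Types V W X Y Z M N : lmodType R.

Lemma artinian_extremal : artinian_ring R -> extremal false R^o.
Proof.
move=> artR F Fc [P0 FP0]; apply: contrapT => nmin.
(* Without a minimal member, every member contains a strictly smaller one, and iterating a choice of
   these contradicts the condition on sequences. *)
have step (P : {P | F P}) : exists Q : {P | F P},
    (forall x, sval Q x -> sval P x) /\ ~ (forall x, sval P x -> sval Q x).
  case: P => P FP; apply: contrapT => nstep; apply: nmin; exists P => // Q FQ QP x.
  split; last exact: QP.
  move: x; apply: contrapT => nPQ; apply: nstep.
  by exists (exist _ Q FQ).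
have [next nextE] := choice step.
pose seq k := iter k next (exist _ P0 FP0).
have [I IE] := choice (fun k => ex_submodule (Fc _ (svalP (seq k)))).
have [|k kE] := artR I.
  by move=> k x /IE; rewrite /seq /= => /(nextE _).1 /IE.
have [_ []] := nextE (seq k) => x /IE xI.
by have /IE := kE k.+1 (leqnSn k) x xI.
Qed.

Lemma homothety V (r : R) : exists f : {linear V -> V}, forall v, f v = r *: v.
Proof. by apply: ex_lin => a x y; rewrite scalerDr !scalerA mulrC. Qed.

(* A module with dcc that is minimal among the non-noetherian ones is a vector
   space over a field, on which a hyperplane exists by Zorn's lemma. *)
Lemma minimal_non_noetherian V : extremal false R^o ->
  (forall Z (g : {linear Z -> V}), injective g -> ~ surj g -> extremal true Z) ->
  extremal true V.
Proof.
move=> dccR noethP; apply: contrapT => nV.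
(* If kernel and image of the homothety were both proper, both would be noetherian, and with them
   [V]. *)
have zero_or_onto r : (forall v : V, r *: v = 0) \/ (forall v : V, exists w : V, r *: w = v).
  have [f fE] := homothety V r; have [Z [g [p [g_inj p_surj pE]]]] := im_module f.
  have [N [k kp]] := ses_ker p_surj; have [k_inj _ kpE] := kp.
  have [g_surj|/(noethP _ _ g_inj) eZ] := pselect (surj g).
    right=> v; have [z <-] := g_surj v; have [w <-] := p_surj z.
    by exists w; rewrite pE fE.
  have [k_surj|/(noethP _ _ k_inj) eN] := pselect (surj k).
    left=> v; have [x <-] := k_surj v.
    by rewrite -fE -pE (ses0 _ kp) linear0.
  by case: nV; exact: extremal_ses kp eN eZ.
have inverse r : ~ (forall v : V, r *: v = 0) -> exists s, forall v : V, s *: (r *: v) = v.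
  move=> nr; have onto : forall v : V, exists w : V, r *: w = v.
    by case: (zero_or_onto r).
  (* The ideals generated by the powers of [r] stabilise, so [r ^+ k = b * r ^+ k.+1]; every vector
     is some [r ^+ k *: w], hence [b] undoes [r]. *)
  pose ideal k (a : R^o) := exists b, a = b * r ^+ k.
  have [||_ [k ->] kmin] := dccR (fun P => exists k, P = ideal k).
  - move=> _ [k ->]; split=> [|a _ _ [b ->] [b' ->]]; first by exists 0; rewrite mul0r.
    by exists (a * b + b'); rewrite mulrDl -mulrA.
  - by exists (ideal 0%N), 0%N.
  have [b bE] : ideal k.+1 (r ^+ k).
    apply/(kmin (ideal k.+1)); first by exists k.+1.
      by move=> _ [b ->]; exists (b * r); rewrite exprS mulrA.
    by exists 1; rewrite mul1r.
  exists b => v; have [w <-] : exists w : V, r ^+ k *: w = v.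
    elim: (k) v => [|j IH] v; first by exists v; rewrite expr0 scale1r.
    have [w1 <-] := onto v; have [w <-] := IH w1.
    by exists w; rewrite exprS scalerA.
  by rewrite !scalerA -mulrA -exprS -bE.
have [x x0] : exists x : V, x <> 0.
  apply: contrapT => nx; apply: nV; apply: extremal_zero => v.
  by apply: contrapT => v0; apply: nx; exists v.
(* Membership of 0 is left out so that the empty union, which Zorn's lemma also tests, qualifies;
   maximality puts 0 into [W] afterwards. *)
pose avoids (A : V -> Prop) := ~ A x /\ forall a u v, A u -> A v -> A (a *: u + v).
have [|W [[Wx Wlin] Wmax]] := @classical_sets.Zorn_bigcup V avoids.
  move=> F Fav Ftot; split=> [[A FA Ax]|a u v [A FA Au] [B FB Bv]].
    by have [] := Fav A FA.
  have [AB|BA] := Ftot A B FA FB.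
    by exists B => //; have [_] := Fav B FB; apply=> //; exact: AB.
  by exists A => //; have [_] := Fav A FA; apply=> //; exact: BA.
have W0 : W 0.
  apply: contrapT => nW0; have nW v : ~ W v.
    by move=> Wv; apply: nW0; rewrite -(addNr v) -scaleN1r; exact: Wlin.
  apply: (Wmax (fun v => v = 0)); first by split=> [v /nW//|]; move=> /(_ 0 erefl).
  by split=> // a u v -> ->; rewrite scaler0 addr0.
have cW : lin_closed W by split.
(* By maximality any [y] outside [W] generates [x] modulo [W], with an invertibly acting
   coefficient; so the image of [x] spans [V] modulo [W], and the quotient is simple. *)
have spanW y : ~ W y -> exists w r, [/\ W w, x = w + r *: y & ~ forall v : V, r *: v = 0].
  move=> nWy; pose B (v : V) := exists w r, W w /\ v = w + r *: y.
  have Bx : B x.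
    apply: contrapT => nBx; apply: (Wmax B).
      split=> [v Wv|]; first by exists v, 0; rewrite scale0r addr0.
      by move=> /(_ y) BW; apply/nWy/BW; exists 0, 1; rewrite scale1r add0r.
    split=> // a _ _ [w [r [Ww ->]]] [w' [r' [Ww' ->]]].
    exists (a *: w + w'), (a * r + r'); split; first exact: Wlin.
    by rewrite scalerDr scalerA scalerDl addrACA.
  have [w [r [Ww xE]]] := Bx; exists w, r; split=> // r0; apply: Wx.
  by rewrite xE r0 addr0.
have [Z [g [g_inj gE]]] := ex_sub cW.
have [X [p gp]] := ses_coker g_inj; have [_ p_surj gpE] := gp.
have {gpE} pW v : p v = 0 <-> W v by rewrite gpE gE.
apply: nV; apply: (extremal_ses gp).
  by apply: (noethP _ g) => // g_surj; apply: Wx; apply/gE.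
have px y : ~ W y -> exists s, p y = s *: p x.
  move=> /spanW [w [r [Ww xE nr]]]; have [s sE] := inverse r nr.
  by exists s; rewrite xE linearD (pW w).2 // add0r -{1}(sE y) linearZ.
apply: extremal_simple => P cP.
have [|nP] := pselect (forall u, P u -> u = 0); [by left|right].
have Px : P (p x).
  apply: contrapT => nPx; apply: nP => u; have [y <-] := p_surj u => Py.
  apply/pW; apply: contrapT => nWy; have [w [r [Ww xE _]]] := spanW y nWy.
  by apply: nPx; rewrite xE linearD (pW w).2 // add0r linearZ; exact: closedZ.
move=> u; have [y <-] := p_surj u.
have [/pW ->|/px [s ->]] := pselect (W y); first by case: cP.
exact: closedZ.
Qed.

(** The descending condition itself supplies an ideal minimal among the non-noetherian ones, and
    [minimal_non_noetherian] rules it out. *)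
Lemma hopkins : artinian_ring R -> fin R^o.
Proof.
move=> /artinian_extremal dccR [] //; apply: contrapT => nR.
have [||P [cP nP] Pmin] := dccR (fun P => lin_closed P /\
    forall Z (g : {linear Z -> R^o}), injective g ->
      (forall x, P x <-> exists z, g z = x) -> ~ extremal true Z).
- by move=> P [].
- exists (fun=> True); split=> // Z g g_inj gE eZ; apply: nR.
  by apply: extremal_surj eZ; move=> x; exact/gE.
have [Z [g [g_inj gE]]] := ex_sub cP.
apply: (nP Z g g_inj gE); apply: minimal_non_noetherian dccR _ => N i i_inj i_nsurj.
apply: contrapT => nN; apply: i_nsurj => z.
have Qmin x : P x <-> exists n, (g \o i) n = x.
  apply: (Pmin (fun x => exists n, (g \o i) n = x)); last first.
    by move=> _ [n <-]; apply/gE; exists (i n).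
  split; first exact: (closed_range (g \o i : {linear N -> R^o})).
  move=> N' j j_inj jE eN'; apply: nN.
  have [|h hE] := corestrict (g := j) (h := g \o i : {linear N -> R^o}) j_inj.
    by move=> n; apply/jE; exists n.
  apply: (extremal_inj (f := h)) eN'.
  by move=> n n' /(congr1 j); rewrite !hE => /= /g_inj /i_inj.
have /Qmin [n /g_inj <-] : P (g z) by apply/gE; exists z.
by exists n.
Qed.

End Hopkins.

(** * Finiteness of modules and of Hom over an Artin algebra *)

Section ArtinAlgebra.
Context {R : comNzRingType} {A : algType R}.
Implicit Types V W X Y Z M N : lmodType A.

(** An alias that carries the [R]-module structure and keeps it apart from the [A]-module structure
    of [M]. *)
Definition restrict_scalars M : Type := M.
HB.instance Definition _ M := GRing.Zmodule.on (restrict_scalars M).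
Definition res_scale M (r : R) (x : restrict_scalars M) : restrict_scalars M :=
  (r%:A : A) *: (x : M).
Lemma res_scaleA M r s (x : restrict_scalars M) : res_scale r (res_scale s x) = res_scale (r * s) x.
Proof. by rewrite /res_scale scalerA mulr_algl scalerA. Qed.
Lemma res_scale1 M : left_id 1 (@res_scale M).
Proof. by move=> x; rewrite /res_scale !scale1r. Qed.
Lemma res_scaleDr M : right_distributive (@res_scale M) +%R.
Proof. by move=> r x y; exact: scalerDr. Qed.
Lemma res_scaleDl M (x : restrict_scalars M) : {morph (@res_scale M)^~ x : r s / r + s}.
Proof. by move=> r s; rewrite /res_scale !scalerDl. Qed.
HB.instance Definition _ M := GRing.Zmodule_isLmodule.Build R (restrict_scalars M)
  (@res_scaleA M) (@res_scale1 M) (@res_scaleDr M) (@res_scaleDl M).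

Hypothesis artA : artin_algebra A.

Lemma artin_algebra_fin : fin A.
Proof.
case: artA => artR fgA b; apply: fin_gen_extremal fgA _; exact: hopkins.
Qed.

Lemma fin_gen_restrict M : fin_gen M -> fin (restrict_scalars M).
Proof.
move=> [m [g gM]] b.
have lin i : linear (fun a : A => (a *: g i) : restrict_scalars M).
  by move=> r x y; rewrite scalerDl -mulr_algl -scalerA.
have [f fE] := choice (fun i => ex_lin (lin i)).
apply: (extremal_sum (f := f)) (artin_algebra_fin b) => v; have [c cE] := gM v.
by exists c; rewrite [LHS]cE; apply: eq_bigr => i _; rewrite fE.
Qed.

Lemma fin_gen_fin_mod M : fin_gen M -> fin M.
Proof.
move=> /fin_gen_restrict finM b F Fc F0.
have [|P FP Pmax] := finM b F _ F0; last by exists P.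
move=> P /Fc [P0 cP]; split=> // r x y; exact: cP.
Qed.

Lemma finE M : fin M <-> fin_gen M.
Proof. by split; [exact: fin_gen_fin | exact: fin_gen_fin_mod]. Qed.

(** A map is determined by its values on [p] generators of [M], so Hom(M, N) embeds over [R] into a
    power of [N], which has finite length over [R]. The predicate [H] describes the image of this
    embedding. *)
Lemma hom_fin_gen M N : fin M -> fin N -> exists m (f : 'I_m -> {linear M -> N}),
  forall h : {linear M -> N}, exists c : 'I_m -> R,
    forall x, h x = \sum_(i < m) (c i)%:A *: f i x.
Proof.
move=> /finE [p [g gM]] /finE /fin_gen_restrict finN.
pose H (u : {ffun 'I_p -> restrict_scalars N}) :=
  exists h : {linear M -> N}, forall i, u i = h (g i).
have cH : lin_closed H.
  split=> [|r u v [h hE] [h' h'E]].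
    by have [o oE] := lin_zero M N; exists o => i; rewrite ffunE oE.
  have [|k kE] := @ex_lin _ M N (fun x => r%:A *: h x + h' x).
    move=> a x y; rewrite !linearP !scalerDr !scalerA mulr_algl mulr_algr.
    by rewrite -!addrA; congr (_ + _); rewrite addrCA.
  by exists k => i; rewrite kE !ffunE hE h'E.
have [Z [j [j_inj jE]]] := ex_sub cH.
have lin i : linear (fun a : restrict_scalars N => [ffun k => if k == i then a else 0]
    : {ffun 'I_p -> restrict_scalars N}).
  move=> r x y; apply/ffunP => k; rewrite !ffunE.
  by case: eqP => // _; rewrite scaler0 addr0.
have [f fE] := choice (fun i => ex_lin (lin i)).
have /extremal_fin_gen [m [z zZ]] : extremal true Z.
  apply: extremal_inj j_inj _; apply: (extremal_sum (f := f)) (finN true) => u.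
  exists u; apply/ffunP => k; rewrite sum_ffunE (bigD1 k) //= fE ffunE eqxx.
  by rewrite big1 ?addr0 // => i ik; rewrite fE ffunE eq_sym (negbTE ik).
have zH i : H (j (z i)) by apply/jE; exists (z i).
have [h hE] := choice zH.
exists m, h => k; have /jE [y yE] : H [ffun i => k (g i)].
  by exists k => i; rewrite ffunE.
have [c cE] := zZ y; exists c.
have kg i : k (g i) = \sum_(t < m) (c t)%:A *: h t (g i).
  transitivity (j y i); first by rewrite yE ffunE.
  rewrite cE linear_sum sum_ffunE; apply: eq_bigr => t _.
  by rewrite linearZ ffunE hE.
move=> x; have [d ->] := gM x; rewrite linear_sum.
under eq_bigr => i _ do rewrite linearZ /= kg scaler_sumr.
rewrite exchange_big; apply: eq_bigr => t _ /=.
rewrite linear_sum scaler_sumr; apply: eq_bigr => i _.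
by rewrite linearZ /= !scalerA mulr_algl mulr_algr.
Qed.

End ArtinAlgebra.

(** * Primitive idempotents *)

Section PrimitiveIdempotents.
Context {A : nzRingType}.
Hypothesis finA : fin A^o.
Implicit Types V W X Y Z M N : lmodType A.

Lemma fin_genP M : fin M <-> fin_gen M.
Proof.
by split=> [|fgM b]; [exact: fin_gen_fin | exact: fin_gen_extremal fgM (finA b)].
Qed.

(* Fitting's lemma for right multiplication by [a] on [A e]: the idempotent
   [f] below projects onto the stable image of [a]. *)
Lemma primitive_fitting (e a : A) : primitive_idempotent e -> e * a = a -> a * e = a ->
  (exists k, a ^+ k.+1 = 0) \/ exists b, e = b * a.
Proof.
move=> [e0 ee prim] ea ae.
pose right_ann k (x : A^o) := x * a ^+ k.+1 = 0.
have [||_ [N ->] Nmax] := @finA true (fun P => exists k, P = right_ann k).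
- move=> _ [k ->]; split=> [|c x y Kx Ky]; first by rewrite /right_ann mul0r.
  by rewrite /right_ann mulrDl -scalerAl Kx Ky scaler0 addr0.
- by exists (right_ann 0%N), 0%N.
pose ideal k (x : A^o) := exists b, x = b * a ^+ k.+1.
have [||_ [k ->] kmin] := @finA false (fun P => exists k, P = ideal k).
- move=> _ [k ->]; split=> [|c _ _ [x ->] [y ->]]; first by exists 0; rewrite mul0r.
  by exists (c * x + y); rewrite mulrDl -mulrA.
- by exists (ideal 0%N), 0%N.
(* The exponent passes both stabilisation indices: right multiplication by [d] is then injective on
   its own image ([dd]), and [d] lies in the left ideal of its square ([bd]). *)
pose d := a ^+ (k.+1 + N.+1).
have dd x : x * d * d = 0 -> x * d = 0.
  rewrite /d -mulrA -exprD => xd.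
  suff xN : x * a ^+ N.+1 = 0 by rewrite addnC exprD mulrA xN mul0r.
  have [||_ ->//] := Nmax (right_ann (k.+1 + N.+1 + (k.+1 + N))%N) _ _ x.
  - by eexists.
  - move=> y yN; rewrite /right_ann.
    have -> : (k.+1 + N.+1 + (k.+1 + N)).+1%N = (N.+1 + (k.+1 + (k.+1 + N.+1)))%N.
      by rewrite -addnS -(addnS k.+1 N) (addnC k.+1 N.+1) !addnA.
    by rewrite exprD mulrA yN mul0r.
  - by rewrite /right_ann -addnS -(addnS k.+1 N); exact: xd.
have [b bd] : exists b, d = b * d * d.
  have [||+ _] := kmin (ideal (k.+1 + N.+1 + k)%N) _ _ (a ^+ k.+1).
  - by eexists.
  - move=> _ [b ->]; exists (b * a ^+ (k.+1 + N.+1)).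
    by rewrite -mulrA -exprD (addnS _ k).
  case=> [|b bE]; first by exists 1; rewrite mul1r.
  exists b; rewrite -mulrA {1}/d exprD {1}bE -mulrA -exprD; congr (b * _).
  by rewrite /d -exprD -(addnS _ k) addnA.
have ed : e * d = d by rewrite /d addSn exprS mulrA ea.
have de : d * e = d by rewrite /d addnS exprSr -mulrA ae.
(* From [d = b * d * d] one gets [f * d = d]. The outcome [f = 0] makes [a] nilpotent, and [f = e]
   exhibits [e] as a left multiple of [a]. *)
pose f := e * b * d.
have fd : f * d = d by rewrite /f -!mulrA [b * _]mulrA -bd ed.
have ef : e * f = f by rewrite /f !mulrA ee.
have fe : f * e = f by rewrite /f -!mulrA de.
have ff : f * f = f.
  apply/eqP; rewrite -subr_eq0; apply/eqP.
  have -> : f * f - f = (f * b - e * b) * d.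
    by rewrite mulrBl {2}/f !mulrA fe.
  apply: dd; rewrite !mulrBl -!mulrA [b * (d * d)]mulrA -bd.
  by rewrite [b * (d * d)]mulrA -bd subrr.
have [|||||f0|g0] := prim f (e - f).
- exact: ff.
- by rewrite mulrBl !mulrBr ee ef fe ff subrr subr0.
- by rewrite mulrBr fe ff subrr.
- by rewrite mulrBl ef ff subrr.
- by rewrite addrC subrK.
- left; exists (k + N.+1)%N.
  by rewrite -addSn -/d -fd f0 mul0r.
right; exists (e * b * a ^+ (k.+1 + N)); rewrite -mulrA -exprSr -addnS -/d -/f.
by apply/eqP; rewrite -subr_eq0 g0.
Qed.

Context {n : nat} (e : 'I_n -> A).
Hypothesis he : complete_primitive_orthogonal e.

Lemma e_idem i : e i * e i = e i.
Proof. by case: he => /(_ i) []. Qed.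

Lemma e_idemZ M i (m : M) : e i *: (e i *: m) = e i *: m.
Proof. by rewrite scalerA e_idem. Qed.

Lemma e_nonzero M : ~ is_zero M -> exists i, exists m : M, e i *: m <> 0.
Proof.
move=> M0; apply: contrapT => ne; apply: M0 => m.
case: he => _ _ e1; rewrite -[m]scale1r -e1 scaler_suml big1 // => i _.
by apply: contrapT => em; apply: ne; exists i, m.
Qed.

Lemma gen_subproof i : (e i : A^o) \in left_ideal_pred (e i).
Proof. by apply/asboolP; exists 1; rewrite mul1r. Qed.

Definition gen i : Pmod e i := exist _ (e i : A^o) (gen_subproof i).

(** [val] retyped into [A], where the ring product is available. *)
Definition pval i (x : Pmod e i) : A := val x.

Lemma pval_inj i : injective (@pval i).
Proof. exact: val_inj. Qed.

Lemma pvalP i a (x y : Pmod e i) : pval (a *: x + y) = a * pval x + pval y.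
Proof. by []. Qed.

Lemma pvalZ i a (x : Pmod e i) : pval (a *: x) = a * pval x.
Proof. by []. Qed.

Lemma pval_gen i : pval (gen i) = e i.
Proof. by []. Qed.

Lemma pval_e i (x : Pmod e i) : pval x * e i = pval x.
Proof.
by rewrite /pval; have /asboolP [b ->] := valP x; rewrite -mulrA e_idem.
Qed.

Lemma genE i (x : Pmod e i) : x = pval x *: gen i.
Proof. by apply: pval_inj; rewrite pvalZ pval_gen pval_e. Qed.

Lemma e_gen i : e i *: gen i = gen i.
Proof. by apply: pval_inj; exact: e_idem. Qed.

Lemma Pmod_hom i M (m : M) : e i *: m = m ->
  exists f : {linear Pmod e i -> M}, f (gen i) = m.
Proof.
move=> em; have [|f fE] := @ex_lin _ (Pmod e i) M (fun x => pval x *: m).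
  by move=> a x y; rewrite pvalP scalerDl scalerA.
by exists f; rewrite fE pval_gen.
Qed.

Lemma Pmod_homE i M (f g : {linear Pmod e i -> M}) : f (gen i) = g (gen i) ->
  forall x, f x = g x.
Proof. by move=> fg x; rewrite (genE x) !linearZ /= fg. Qed.

Lemma Pmod_full i (P : Pmod e i -> Prop) : lin_closed P -> P (gen i) -> forall x, P x.
Proof. by move=> cP Pg x; rewrite (genE x); exact: closedZ. Qed.

Lemma Pmod_projective i : projective (Pmod e i).
Proof.
move=> M N g f g_surj; have [m mE] := g_surj (f (gen i)).
have [h hE] := @Pmod_hom i M (e i *: m) (e_idemZ i m).
exists h; apply: (@Pmod_homE i N (g \o h)).
by rewrite /= hE linearZ /= mE -linearZ /= e_gen.
Qed.

Lemma Pmod_fin i : fin (Pmod e i).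
Proof.
apply/fin_genP; exists 1%N, (fun=> gen i) => x.
by exists (fun=> pval x); rewrite big_ord1 -genE.
Qed.

(** Fitting's alternative for [a] in the corner ring of [e i]: if [a] is nilpotent then [1 - a] is
    invertible and [x] generates; otherwise [e i] is a left multiple of [a] and [y] generates. *)
Lemma Pmod_local i (P Q : Pmod e i -> Prop) x y : lin_closed P -> lin_closed Q ->
  P x -> Q y -> x + y = gen i -> P (gen i) \/ Q (gen i).
Proof.
move=> cP cQ Px Qy xy; pose a := e i * pval y.
have valE : pval x + pval y = e i by rewrite -pval_gen -xy.
have ea : e i * a = a by rewrite mulrA e_idem.
have ae : a * e i = a by rewrite -mulrA pval_e.
have prim_i : primitive_idempotent (e i) by case: he.
have [[k ak]|[b bE]] := primitive_fitting prim_i ea ae; [left|right].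
  (* The geometric sum inverting [1 - a]. *)
  pose u := \sum_(j < k.+1) a ^+ j.
  have ua : u * (1 - a) = 1.
    have -> : u * (1 - a) = (1 - a) * u.
      rewrite mulrBr mulrBl mulr1 mul1r; congr (_ - _).
      by apply/esym/commr_sum => j _; exact: commrX.
    by rewrite -opprB mulNr -subrX1 ak sub0r opprK.
  have -> : gen i = (u * e i) *: x; last exact: closedZ.
  apply: pval_inj; rewrite pvalZ pval_gen -mulrA.
  have -> : e i * pval x = (1 - a) * e i.
    by rewrite mulrBl mul1r ae; apply/esym/eqP; rewrite subr_eq -mulrDr valE e_idem.
  by rewrite mulrA ua mul1r.
have -> : gen i = (b * e i) *: y; last exact: closedZ.
by apply: pval_inj; rewrite pvalZ pval_gen {1}bE -mulrA.
Qed.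

(* The largest proper submodule of [A e_i], which is its radical. *)
Definition proper_part i (x : Pmod e i) : Prop :=
  exists P : Pmod e i -> Prop, [/\ lin_closed P, ~ P (gen i) & P x].

Lemma proper_part_gen i : ~ proper_part (gen i).
Proof. by case=> P []. Qed.

(** By locality the sum of two proper submodules is again proper. *)
Lemma proper_part_closed i : lin_closed (@proper_part i).
Proof.
split=> [|a x y [P [cP nP Px]] [Q [cQ nQ Qy]]].
  exists (fun x => x = 0); split=> //; first exact: closed_zero.
  move=> /(congr1 (@pval i)); rewrite pval_gen => e0.
  by case: he => /(_ i) [/eqP].
exists (fun z => exists y z', [/\ P y, Q z' & z = y + z']).
split; first exact: closed_add.
  move=> [u [v [Pu Qv uv]]].
  by have [] := Pmod_local cP cQ Pu Qv (esym uv).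
by exists (a *: x), y; split=> //; exact: closedZ.
Qed.

Lemma rad_PmodE i x : x \in @rad_pred A (Pmod e i) <-> proper_part x.
Proof.
have [J JE] := ex_submodule (@proper_part_closed i).
split=> [/asboolP rx|[P [cP nP Px]]].
  apply/JE; apply: rx; split=> [/(_ (gen i)) /JE /proper_part_gen //|W JW].
  have [Wg|nWg] := pselect (gen i \in W).
    by right; apply: (Pmod_full (closed_submodule W)).
  by left=> y Wy; apply/JE; exists (fun z => z \in W); split=> //; exact: closed_submodule.
apply/asboolP => U [Uproper Umax].
have UJ : submodule_le U J.
  move=> y Uy; apply/JE; exists (fun z => z \in U); split=> //.
    exact: closed_submodule.
  by move=> Ug; apply: Uproper; exact: (Pmod_full (closed_submodule U)).
have [JU|Jall] := Umax J UJ; first by apply/JU/JE; exists P.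
by have /JE /proper_part_gen := Jall (gen i).
Qed.

Lemma Emod_proj i : exists q : {linear Pmod e i -> Emod e i},
  surj q /\ forall x, q x = 0 <-> proper_part x.
Proof.
have [q [q_surj qE]] := quotmod_proj (@rad_pred A (Pmod e i) : submodule _).
by exists q; split=> // x; rewrite qE rad_PmodE.
Qed.

Lemma Emod_simple i : simple_module (Emod e i).
Proof.
have [q [q_surj qE]] := Emod_proj i; apply/simple_moduleP; split.
  by move=> E0; apply: (@proper_part_gen i); apply/qE/E0.
move=> P cP; have [Pg|nPg] := pselect (P (q (gen i))); [right|left].
  by move=> y; have [x <-] := q_surj y; exact: (Pmod_full (closed_preim q cP)).
move=> y; have [x <-] := q_surj y => Px; apply/qE.
by exists (fun x => P (q x)); split=> //; exact: closed_preim.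
Qed.

(* [e_l M = 0], that is, [E(l)] is not a composition factor of [M]. *)
Definition dead (l : 'I_n) M : Prop := forall m : M, e l *: m = 0.

Lemma dead_inj l M N (f : {linear M -> N}) : injective f -> dead l N -> dead l M.
Proof. by move=> f_inj dN m; apply: (inj_eq0 f_inj); rewrite linearZ /= dN. Qed.

Lemma dead_surj l M N (f : {linear M -> N}) : surj f -> dead l M -> dead l N.
Proof. by move=> f_surj dM y; have [m <-] := f_surj y; rewrite -linearZ /= dM linear0. Qed.

Lemma dead_iso l M N : iso M N -> dead l M -> dead l N.
Proof. by move=> /iso_mapP [f [g [fK gK]]]; apply: dead_inj; exact: can_inj gK. Qed.

Lemma dead_ses l Z M X (g : {linear Z -> M}) (p : {linear M -> X}) :
  ses g p -> dead l Z -> dead l X -> dead l M.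
Proof.
move=> [_ _ gpE] dZ dX m; have /gpE [z zE] : p (e l *: m) = 0.
  by rewrite linearZ /= dX.
by rewrite -e_idemZ -zE -linearZ /= dZ linear0.
Qed.

Lemma Emod_not_dead i : ~ dead i (Emod e i).
Proof.
have [q [q_surj qE]] := Emod_proj i => /(_ (q (gen i))).
by rewrite -linearZ /= e_gen => /qE /proper_part_gen.
Qed.

(** An element not killed by [e i] gives a map of P(i) onto [S]; its kernel is the largest proper
    submodule, which is also the kernel of the projection to E(i). *)
Lemma simple_iso_Emod i S : simple_module S -> ~ dead i S -> iso S (Emod e i).
Proof.
move=> /simple_moduleP [S0 simpS] ndS.
have [s es] : exists s : S, e i *: s <> 0.
  by apply: contrapT => ns; apply: ndS => s; apply: contrapT => es; apply: ns; exists s.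
have [f fE] := Pmod_hom (e_idemZ i s).
have f_surj : surj f.
  by have [im0|//] := simpS _ (closed_range f); case: es; apply: im0; exists (gen i).
have [q [q_surj qE]] := Emod_proj i.
have fq x : f x = 0 <-> proper_part x.
  split=> [fx|[P [cP nP Px]]].
    exists (fun x => f x = 0); split=> //; first exact: (closed_preim f (closed_zero S)).
    by rewrite fE.
  have [P0|Pall] := simpS _ (closed_im f cP); first by apply: P0; exists x.
  have [y Py fy] := Pall (f (gen i)).
  case: (@proper_part_gen i); rewrite -(subrK y (gen i)).
  apply: closedD; first exact: proper_part_closed; last by exists P.
  exists (fun x => f x = 0); split.
  - exact: (closed_preim f (closed_zero S)).
  - by rewrite fE.
  - by rewrite linearB fy subrr.
have [|h hE] := @factor_surj _ _ _ _ f q f_surj.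
  by move=> x /fq /qE.
apply: (isoE (f := h)) => [|y]; last by have [x <-] := q_surj y; exists (f x).
by apply: inj_lin => y; have [x <-] := f_surj y; rewrite hE => /qE /fq.
Qed.

Hypothesis hbasic : basic_algebra e.

(** Otherwise E(i) and E(l) are isomorphic, and projectivity lifts this to an isomorphism of P(i)
    with P(l), which basicness forbids. *)
Lemma Emod_dead i l : i != l -> dead l (Emod e i).
Proof.
move=> il; apply: contrapT => nd.
have [u [v [uK vK]]] := iso_mapP (simple_iso_Emod (Emod_simple i) nd).
have [q [q_surj qE]] := Emod_proj i; have [r [r_surj rE]] := Emod_proj l.
have [f fE] := Pmod_projective (u \o q : {linear Pmod e i -> Emod e l}) r_surj.
have uq0 : u (q (gen i)) <> 0.
  by move=> /(inj_eq0 (can_inj uK)) /qE /proper_part_gen.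
have f_surj : surj f.
  apply: (Pmod_full (closed_range f)); apply: contrapT => nf; apply: uq0.
  rewrite -[LHS](fE (gen i)); apply/rE; exists (fun y => exists x, f x = y).
  by split=> //; [exact: closed_range | exists (gen i)].
have [s sE] := Pmod_projective (idfun : {linear Pmod e l -> Pmod e l}) f_surj.
(* A section with proper image would send the generator into the kernel of [q], forcing [gen l] into
   the proper part. With [s] onto, [f] is injective. *)
have s_surj : surj s.
  apply: (Pmod_full (closed_range s)); apply: contrapT => ns.
  apply: (@proper_part_gen l); apply/rE; rewrite -[gen l]sE fE /=.
  suff /qE -> : proper_part (s (gen l)) by rewrite linear0.
  by exists (fun y => exists x, s x = y); split=> //; [exact: closed_range | exists (gen l)].
apply: (hbasic il); apply: (isoE (f := f)) => // x y.
by have [x' <-] := s_surj x; have [y' <-] := s_surj y; rewrite !sE /= => ->.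
Qed.

End PrimitiveIdempotents.

(** * Standard modules *)

Section StandardModules.
Context {A : nzRingType} {n : nat} (e : 'I_n -> A).
Hypothesis finA : fin A^o.
Hypothesis he : complete_primitive_orthogonal e.
Implicit Types V W X Y Z M N D P S : lmodType A.

Lemma fin_filt_simple M : fin M -> filt simple_module M.
Proof.
move: M; apply: quotient_ind => M finM IH.
have [M0|M0] := pselect (is_zero M); first exact: Filt0.
have [Z [g [g_inj simpZ]]] := nonzero_simple_sub (finM false) M0.
have [X [p gp]] := ses_coker g_inj; have [_ p_surj gpE] := gp.
apply: (filt_ses gp); first exact: filt_one.
apply: IH p_surj _ => p_inj; case/simple_moduleP: simpZ => Z0 _; apply: Z0 => z.
by apply: (inj_eq0 g_inj); apply: (inj_eq0 p_inj); exact: ses0 gp.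
Qed.

Lemma fin_composition_series M : fin M -> exists l (N : nat -> submodule M), composition_series l N.
Proof.
move=> /fin_filt_simple /filt_filtered [l [N [chN NS]]].
exists l, N; split=> // k /NS [S simpS] /iso_sym SN; exact: simple_iso SN simpS.
Qed.

Lemma factor_dead l M (U W : submodule M) :
  dead e l (factor U W) <-> forall x, x \in W -> e l *: x \in U.
Proof.
have [q [q_surj qE]] := quotmod_proj (restrict_pred U W).
have qU x : q x = 0 <-> val x \in U by rewrite qE.
split=> [dF x xW|dW y].
  have := dF (q (exist _ x xW)); rewrite -linearZ /= => /qU.
  by [].
have [x <-] := q_surj y; rewrite -linearZ /=; apply/qU.
exact: dW (valP x).
Qed.

Lemma simple_factor_dead i M (U W : submodule M) : simple_module (factor U W) ->
  ~ iso (factor U W) (Emod e i) -> dead e i (factor U W).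
Proof. by move=> simpF niF; apply: contrapT => /(simple_iso_Emod finA he simpF). Qed.

Lemma iso_Emod_not_dead i S : iso S (Emod e i) -> ~ dead e i S.
Proof. by move=> SE dS; apply: (Emod_not_dead finA he (i := i)); exact: dead_iso dS. Qed.

(** Idempotence lets [e i] be applied once for each layer, descending one step every time. *)
Lemma series_dead i M (N : nat -> submodule M) j d :
  (forall t, (j <= t < j + d)%N -> dead e i (factor (N t) (N t.+1))) ->
  forall x, x \in N (j + d)%N -> e i *: x \in N j.
Proof.
elim: d => [|d IH] dN x; first by rewrite addn0 => Nx; rewrite rpredZ.
rewrite addnS => Nx; rewrite -(e_idemZ he); apply: IH => [t /andP [jt td]|].
  by apply: dN; rewrite jt addnS ltnS ltnW.
by apply: (factor_dead _ _ _).1 Nx; apply: dN; rewrite leq_addr addnS ltnSn.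
Qed.

Lemma composition_factorP i M : fin M ->
  composition_factor M (Emod e i) <-> ~ dead e i M.
Proof.
move=> finM; split=> [[c c0 [l [N [[chN simpN] cE]]]] dM|ndM].
  move: c0; rewrite -cE => /card_gt0P [k]; rewrite inE => /asboolP /iso_Emod_not_dead.
  by apply; apply/factor_dead => x _; rewrite dM rpred0.
have [l [N [[N0 Nl Nle] NS]]] := fin_composition_series finM.
exists #|[pred k : 'I_l | `[< iso (factor (N k) (N k.+1)) (Emod e i) >]]|; last by exists l, N.
apply/card_gt0P; apply: contrapT => nk; apply: ndM => m; apply: N0.
apply: (@series_dead i M N 0 l); last by rewrite add0n.
move=> t; rewrite leq0n add0n => tl; apply: simple_factor_dead; first exact: NS.
by move=> isoN; apply: nk; exists (Ordinal tl); rewrite inE; apply/asboolP.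
Qed.

Lemma no_factor_aboveP i M : fin M ->
  no_factor_above e i M <-> forall l : 'I_n, (i < l)%N -> dead e l M.
Proof.
move=> finM; split=> [nM l il|dM l il /(composition_factorP _ finM)].
  by apply: contrapT => /(composition_factorP _ finM); exact: nM.
by apply; exact: dM.
Qed.

Lemma factor_zero_iso M (U W : submodule M) : (forall x, x \in U -> x = 0) ->
  iso (factor U W) (submod W).
Proof.
move=> U0; apply/factorP; exists (idfun : {linear submod W -> submod W}).
split=> [x|x]; first by exists x.
by split=> [/= ->|/U0 x0]; [exact: rpred0 | exact: val_inj].
Qed.

(* The trace of the [P(l)], [l > j], in [M]. *)
Definition tr (j : nat) M (x : M) : Prop := forall Q : M -> Prop, lin_closed Q ->
  (forall (l : 'I_n) (m : M), (j < l)%N -> Q (e l *: m)) -> Q x.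

Lemma tr_closed j M : lin_closed (@tr j M).
Proof.
split=> [Q [] //|a x y trx tr_y Q cQ Qe].
by case: (cQ) => _; apply; [exact: trx | exact: tr_y].
Qed.

Lemma tr_gen j M (l : 'I_n) (m : M) : (j < l)%N -> tr j (e l *: m).
Proof. by move=> jl Q _; exact. Qed.

Lemma tr_map j M N (f : {linear M -> N}) x : tr j x -> tr j (f x).
Proof.
move=> trx; apply: (trx (fun x => tr j (f x))).
  exact: closed_preim (tr_closed j N).
by move=> l m jl; rewrite linearZ; exact: tr_gen.
Qed.

Lemma tr_surj j M N (f : {linear M -> N}) y : surj f -> tr j y ->
  exists2 x, tr j x & f x = y.
Proof.
move=> f_surj try; apply: (try (fun y => exists2 x, tr j x & f x = y)).
  exact: closed_im (tr_closed j M).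
move=> l m jl; have [x <-] := f_surj m; exists (e l *: x); first exact: tr_gen.
by rewrite linearZ.
Qed.

Lemma tr_dead j M (x : M) : (forall l : 'I_n, (j < l)%N -> dead e l M) ->
  tr j x -> x = 0.
Proof. by move=> dM trx; apply: (trx (fun x => x = 0)); [exact: closed_zero | move=> l m /dM]. Qed.

Lemma tr_quotient_dead j M X (p : {linear M -> X}) : surj p ->
  (forall x, tr j x -> p x = 0) -> forall l : 'I_n, (j < l)%N -> dead e l X.
Proof.
move=> p_surj ptr l jl y; have [x <-] := p_surj y.
by rewrite -linearZ /=; apply: ptr; exact: tr_gen.
Qed.

(** Delta(i) as P(i) modulo the trace of the P(l) with [l > i]; unlike [standard], which fixes one
    quotient type, this form is convenient up to isomorphism. *)
Definition standard_proj i D (p : {linear Pmod e i -> D}) : Prop :=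
  surj p /\ forall x, p x = 0 <-> tr i x.

Lemma standardP i D : standard e i D -> exists p : {linear Pmod e i -> D}, standard_proj p.
Proof.
case=> U [nU Umin] ->; have [p [p_surj pE]] := quotmod_proj U.
have fin_quo (W : submodule (Pmod e i)) : fin (quotmod W).
  have [q [q_surj _]] := quotmod_proj W.
  exact: (fin_surj q_surj (@Pmod_fin _ finA _ _ he i)).
exists p; split=> // x; rewrite pE; split=> [Ux|trx].
  have [W WE] := ex_submodule (@tr_closed i (Pmod e i)).
  apply/WE; apply: Umin Ux; apply/(no_factor_aboveP _ (fin_quo W)).
  have [q [q_surj qE]] := quotmod_proj W.
  by apply: tr_quotient_dead q_surj _ => y try; apply/qE/WE.
apply/pE; move/(no_factor_aboveP _ (fin_quo U)): nU => dU.
exact: tr_dead dU (tr_map p trx).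
Qed.

Lemma ex_standard i : exists D, standard e i D.
Proof.
have [W WE] := ex_submodule (@tr_closed i (Pmod e i)).
exists (quotmod W), W => //.
have fin_quo (U : submodule (Pmod e i)) : fin (quotmod U).
  have [q [q_surj _]] := quotmod_proj U.
  exact: (fin_surj q_surj (@Pmod_fin _ finA _ _ he i)).
split=> [|U /(no_factor_aboveP _ (fin_quo U)) dU x /WE trx].
  apply/(no_factor_aboveP _ (fin_quo W)).
  have [q [q_surj qE]] := quotmod_proj W.
  by apply: tr_quotient_dead q_surj _ => y try; apply/qE/WE.
have [q [q_surj qE]] := quotmod_proj U.
by apply/qE; exact: tr_dead dU (tr_map q trx).
Qed.

Lemma standard_iso i D (D' : lmodType A) (p : {linear Pmod e i -> D}) (p' : {linear Pmod e i -> D'}) :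
  standard_proj p -> standard_proj p' -> iso D D'.
Proof.
move=> [p_surj pE] [p'_surj p'E].
have [|h hE] := @factor_surj _ _ _ _ p p' p_surj; first by move=> x /pE /p'E.
apply: (isoE (f := h)) => [|y]; last by have [x <-] := p'_surj y; exists (p x).
by apply: inj_lin => y; have [x <-] := p_surj y; rewrite hE => /p'E /pE.
Qed.

Definition Dmod i : lmodType A := sval (cid (ex_standard i)).

Lemma Dmod_Delta i : Delta e (Dmod i).
Proof. by exists i; exact: svalP (cid (ex_standard i)). Qed.

Lemma Dmod_proj i : exists p : {linear Pmod e i -> Dmod i}, standard_proj p.
Proof. apply: standardP; exact: svalP (cid (ex_standard i)). Qed.

Lemma Delta_iso D : Delta e D -> exists i, iso (Dmod i) D.
Proof.
case=> i /standardP [p pD]; exists i; have [q qD] := Dmod_proj i.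
exact: standard_iso qD pD.
Qed.

Lemma Dmod_fin i : fin (Dmod i).
Proof. by have [p [p_surj _]] := Dmod_proj i; exact: (fin_surj p_surj (@Pmod_fin _ finA _ _ he i)). Qed.

Lemma filt_Delta_fin M : filt (Delta e) M -> fin M.
Proof. by apply: fin_filt => X /Delta_iso [i /fin_iso]; apply; exact: Dmod_fin. Qed.

Lemma Dmod_dead (i l : 'I_n) : (i < l)%N -> dead e l (Dmod i).
Proof.
have [p [p_surj pE]] := Dmod_proj i.
by apply: (tr_quotient_dead (j := i) p_surj) => x; rewrite pE.
Qed.

Lemma Dmod_presented i : presented (Dmod i).
Proof.
have [p [p_surj _]] := Dmod_proj i; have [Z [g gp]] := ses_ker p_surj.
exists Z, (Pmod e i), g, p; split=> //; exact: Pmod_projective.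
Qed.

(** The kernel of P(i) -> Delta(i) is generated by elements fixed by some [e l] with [l > i], so it
    has no nonzero map to [Y], and the zero map extends. *)
Lemma ext0_Dmod_dead (i : 'I_n) Y : (forall l : 'I_n, (i < l)%N -> dead e l Y) -> ext0 (Dmod i) Y.
Proof.
move=> dY; have [p [p_surj pE]] := Dmod_proj i; have [Z [g gp]] := ses_ker p_surj.
apply: (ext0_pres (Pmod_projective he (i := i)) gp) => f.
have [o oE] := lin_zero (Pmod e i) Y; exists o => z; rewrite oE.
have [g_inj _ gpE] := gp.
have trz : tr i (g z) by apply/pE/gpE; exists z.
have [||z' f0 gz'] := trz (fun x => exists2 z, f z = 0 & g z = x).
- exact: closed_im (closed_preim f (closed_zero Y)).
- move=> l m il; have /gpE [z' z'E] : p (e l *: m) = 0 by apply/pE; exact: tr_gen.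
  exists (e l *: z'); rewrite linearZ /=; first exact: dY.
  by rewrite z'E (e_idemZ he).
by rewrite -(g_inj _ _ gz').
Qed.

Lemma inj_iso Z (Z' : lmodType A) M (g : {linear Z -> M}) (g' : {linear Z' -> M}) :
  injective g -> injective g' ->
  (forall x, (exists z, g z = x) <-> exists z, g' z = x) -> iso Z Z'.
Proof.
move=> g_inj g'_inj gg'.
have [|h hE] := corestrict (g := g') (h := g) g'_inj.
  by move=> z; apply/gg'; exists z.
apply: (isoE (f := h)) => [z z' /(congr1 g')|z']; first by rewrite !hE => /g_inj.
have /gg' [z zE] : exists z, g' z = g' z' by exists z'.
by exists z; apply: g'_inj; rewrite hE.
Qed.

(* In a module with a standard filtration, passing to the trace of the P(l),
   l > j, deletes the layers Delta(i) with i <= j. *)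
Lemma ext0_tr M j Y : filt (Delta e) M ->
  (forall l : 'I_n, (j < l)%N -> ext0 (Dmod l) Y) ->
  forall Z (g : {linear Z -> M}), injective g ->
  (forall x, tr j x <-> exists z, g z = x) -> ext0 Z Y.
Proof.
move=> FM eY; elim: FM => {M} [M M0|M' M X g p gp _ IH /Delta_iso [i iX]] Z k k_inj kE.
  apply: ext0_proj; apply: projective_zero => z.
  by apply: (inj_eq0 k_inj); exact: M0.
have [Z' [k' [k'_inj k'E]]] := ex_sub (tr_closed j M').
have {IH} eZ' := IH Z' k' k'_inj k'E.
have [g_inj p_surj gpE] := gp.
(* For [i <= j] the top layer is killed by all [e l] with [l > j], so the trace of [M] lies in [M']
   and is the trace of [M']. *)
have [ij|ji] := leqP i j.
  apply: ext0_iso_l eZ'; apply: (inj_iso (g := g \o k') (g' := k)) => //.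
    exact: inj_comp.
  move=> x; rewrite -kE; split=> [[z' <-]|trx]; first by apply: (tr_map g); apply/k'E; exists z'.
  apply: (trx (fun x => exists z', (g \o k') z' = x)).
    exact: (closed_range (g \o k' : {linear Z' -> M})).
  move=> l m jl; have /gpE [m' m'E] : p (e l *: m) = 0.
    by rewrite linearZ /= (dead_iso iX (Dmod_dead (leq_ltn_trans ij jl))).
  have /k'E [z' z'E] : tr j (e l *: m') by exact: tr_gen.
  by exists z'; rewrite /= z'E linearZ /= m'E (e_idemZ he).
(* For [i > j] the trace of [M] has to meet [M'] exactly in the trace of [M']. The quotient [W] is
   dead above [j], so [q] extends to [M] because Ext^1(Delta(i), W) = 0, and this extension kills
   the trace of [M]. *)
have [W [q [q_surj qE]]] := ex_quo (tr_closed j M').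
have dW : forall l : 'I_n, (j < l)%N -> dead e l W.
  by apply: tr_quotient_dead q_surj _ => x /qE.
have [h hE] : exists h : {linear M -> W}, forall x, h (g x) = q x.
  apply: (ext0_iso_l iX (ext0_Dmod_dead _) gp) => l il.
  by apply: dW; exact: ltn_trans il.
have [|g' g'E] := corestrict (g := k) (h := g \o k' : {linear Z' -> M}) k_inj.
  by move=> z'; apply/kE; apply: (tr_map g); apply/k'E; exists z'.
suff gp' : ses g' (p \o k : {linear Z -> X}).
  by apply: (ext0_middle_l gp' eZ'); exact: ext0_iso_l iX (eY i ji).
split=> [x y /(congr1 k)|x|z].
- by rewrite !g'E /= => /g_inj /k'_inj.
(* Delta(i) is generated by an element fixed by [e i], and [i > j], so it is its own trace. *)
- have trX : tr j x.
    have [r [r_surj rE]] := Dmod_proj i; have [u [v [_ vK]]] := iso_mapP iX.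
    have [y <-] : exists y, (u \o r) y = x.
      by have [y yE] := r_surj (v x); exists y; rewrite /= yE vK.
    apply: (tr_map (u \o r)); rewrite (genE he y).
    apply: (closedZ _ (tr_closed j (Pmod e i))).
    by rewrite -(e_gen he); exact: tr_gen.
  have [m /kE [z <-] pm] := tr_surj p_surj trX.
  by exists z.
split=> [/gpE [m' m'E]|[z' <-]]; last by rewrite /= g'E (ses0 _ gp).
have /k'E [z' z'E] : tr j m'.
  apply/qE; rewrite -hE m'E; apply: tr_dead dW _; apply: tr_map.
  by apply/kE; exists z.
by exists z'; apply: k_inj; rewrite g'E /= z'E m'E.
Qed.

Hypothesis hstrat : standardly_stratified e.

(** The syzygy is the trace of P(i). Since P(i) is a summand of [A], its trace is a retract of the
    trace of [A], to which [ext0_tr] applies. *)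
Lemma Dmod_syzygy i : exists Z P (g : {linear Z -> P}) (p : {linear P -> Dmod i}),
  [/\ projective P, fin P, ses g p & forall Y,
    (forall l : 'I_n, (i < l)%N -> ext0 (Dmod l) Y) -> ext0 Z Y].
Proof.
have [p [p_surj pE]] := Dmod_proj i; have [Z [g gp]] := ses_ker p_surj.
exists Z, (Pmod e i), g, p; split=> //.
- exact: Pmod_projective.
- exact: Pmod_fin.
move=> Y eY; have FA := filtered_filt hstrat.
have [Z' [k [k_inj kE]]] := ex_sub (tr_closed i A^o).
have eZ' := ext0_tr FA eY k_inj kE.
have [g_inj _ gpE] := gp.
have gE x : tr i x <-> exists z, g z = x by rewrite -pE gpE.
have [|a aE] := @ex_lin _ (Pmod e i) A^o (fun x => pval x) => //.
have [|b bE] := @ex_lin _ A^o (Pmod e i) (fun x => (x : A) *: gen e i).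
  by move=> c x y; rewrite scalerDl scalerA.
have abK : cancel a b by move=> x; rewrite bE aE -(genE he).
have [|a' a'E] := corestrict (g := k) (h := a \o g : {linear Z -> A^o}) k_inj.
  by move=> z; apply/kE; apply: (tr_map a); apply/gE; exists z.
have [|b' b'E] := corestrict (g := g) (h := b \o k : {linear Z' -> Pmod e i}) g_inj.
  by move=> z; apply/gE; apply: (tr_map b); apply/kE; exists z.
apply: (ext0_retract (a := a') (b := b')) eZ' => z.
by apply: g_inj; rewrite b'E /= a'E /= abK.
Qed.

End StandardModules.

(** * Proper costandard modules *)

Section ProperCostandardModules.
Context {A : nzRingType} {n : nat} (e : 'I_n -> A) (I : 'I_n -> lmodType A).
Hypothesis finA : fin A^o.
Hypothesis he : complete_primitive_orthogonal e.
Hypothesis hbasic : basic_algebra e.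
Hypothesis hI : forall i, fin_gen (I i) /\ injective_envelope (Emod e i) (I i).
Implicit Types V W X Y Z M N D P S : lmodType A.

Lemma I_fin i : fin (I i).
Proof. by apply/(fin_genP finA); case: (hI i). Qed.

Lemma I_injective i : injective_module (I i).
Proof. by case: (hI i) => _ []. Qed.

Definition socle i : {linear Emod e i -> I i} := sval (cid (hI i).2.2).

Lemma socle_inj i : injective (@socle i).
Proof. by rewrite /socle; case: cid => f []. Qed.

Lemma socle_essential i (P : I i -> Prop) x : lin_closed P -> P x -> x <> 0 ->
  forall y, P (socle i y).
Proof.
move=> cP Px x0; have [U UE] := ex_submodule cP.
have [y0 y00 Py0] : exists2 y, y != 0 & socle i y \in U.
  rewrite /socle; case: cid => f [f_inj f_ess] /=; apply: f_ess.
  by exists x; [apply/UE | apply/eqP].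
have /simple_moduleP [_ simpE] := Emod_simple finA he i.
have [P0|//] := simpE _ (closed_preim (socle i) cP).
by case/eqP: y00; apply: P0; apply/UE.
Qed.

Lemma socle_nonzero i : exists y, socle i y <> 0.
Proof.
apply: contrapT => ny; have /simple_moduleP [E0 _] := Emod_simple finA he i; apply: E0 => y.
by apply: (inj_eq0 (@socle_inj i)); apply: contrapT => iy; apply: ny; exists y.
Qed.

(* Nonzero submodules of [I(i)] contain the socle, so a single factor isomorphic
   to [E(i)] must be the bottom of the composition series. *)
Lemma multiplicity1P i M (u : {linear M -> I i}) : fin M -> injective u ->
  multiplicity M (Emod e i) 1 <->
  ~ is_zero M /\ forall m, exists y, socle i y = u (e i *: m).
Proof.
move=> finM u_inj.
have ess (P : M -> Prop) x : lin_closed P -> P x -> x <> 0 ->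
    forall y, exists2 m, P m & u m = socle i y.
  move=> cP Px x0; apply: (@socle_essential i (fun v => exists2 m, P m & u m = v) (u x)); first exact: closed_im.
    by exists x.
  by move=> /(inj_eq0 u_inj).
have cE : lin_closed (fun m => exists y, socle i y = u m).
  exact: (closed_preim u (closed_range (socle i))).
(* By essentiality the lowest nonzero layer is the socle. *)
have layer (N : nat -> submodule M) k : (forall x, x \in N k -> x = 0) ->
    simple_module (factor (N k) (N k.+1)) ->
    (exists x, x \in N k.+1 /\ x <> 0) /\
    (forall x, x \in N k.+1 <-> exists y, socle i y = u x).
  move=> Nk0 /(simple_iso (factor_zero_iso _ Nk0)) /simple_moduleP [N0 simpN].
  have [x [xN x0]] : exists x, x \in N k.+1 /\ x <> 0.
    apply: contrapT => nx; apply: N0 => x; apply: val_inj; apply: contrapT => x0.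
    by apply: nx; exists (val x); split=> //; exact: valP.
  have NE y : exists2 m, m \in N k.+1 & u m = socle i y.
    exact: (ess (fun x => x \in N k.+1) x (closed_submodule (N k.+1)) xN x0).
  split; [by exists x | move=> m; split=> [mN|[y]]]; last first.
    by have [m' m'N <-] := NE y; move=> /u_inj <-.
  have [g gE] := submod_emb (N k.+1).
  have [P0|Pall] := simpN _ (closed_preim g cE).
    have [y iy] := socle_nonzero i; have [m' m'N um'] := NE y; case: iy.
    rewrite -um'; have -> : m' = val (exist _ m' m'N : submod (N k.+1)) by [].
    by rewrite (P0 (exist _ m' m'N)) ?linear0 // gE /= um'; exists y.
  by have := Pall (exist _ m mN); rewrite gE.
split=> [[l [N [[[N0 Nl Nle] NS] NE]]]|[M0 ME]].
  pose isE (k : 'I_l) := iso (factor (N k) (N k.+1)) (Emod e i).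
  have /eqP/cards1P [k kE] : #|[set k : 'I_l | `[< isE k >]]| = 1%N by rewrite cardsE.
  have isEk (j : 'I_l) : isE j -> j = k.
    by move=> jE; apply/set1P; rewrite -kE inE; apply/asboolP.
  have kisE : isE k by apply/asboolP; have := set11 k; rewrite -kE inE.
  have dN (j : nat) : (j < l)%N -> j != k -> dead e i (factor (N j) (N j.+1)).
    move=> jl jk; apply: (simple_factor_dead finA he); first exact: NS.
    by move=> jE; case/eqP: jk; rewrite -(isEk (Ordinal jl)).
  (* The layers below [k] are dead at [i], so [e i] kills [N k]; a nonzero [N k] would contain the
     socle, which [e i] does not kill. *)
  have Nk0 x : x \in N k -> x = 0.
    move=> xN; apply: contrapT => x0; have [y iy] := socle_nonzero i.
    apply: (Emod_not_dead finA he (i := i)) => y'; apply: (@socle_inj i).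
    have [m mN um] := ess _ x (closed_submodule (N k)) xN x0 y'.
    rewrite linear0 linearZ /= -um -linearZ /= (N0 (e i *: m)) ?linear0 //.
    apply: (series_dead he (N := N) (j := 0%N) (d := k)); last by rewrite add0n.
    move=> t; rewrite leq0n add0n => tk.
    by apply: dN; [exact: ltn_trans (ltn_ord k) | rewrite ltn_eqF].
  have [[x [xN x0]] Nk1] := layer N k Nk0 (NS k (ltn_ord k)).
  split; first by move=> M0; apply: x0; exact: M0.
  move=> m; apply/Nk1; apply: (series_dead he (N := N) (d := (l - k.+1)%N)).
    rewrite subnKC ?ltn_ord // => t /andP [kt tl].
    by apply: dN => //; rewrite gtn_eqF.
  by rewrite subnKC ?ltn_ord.
have [l [N [[N0 Nl Nle] NS]]] := fin_composition_series finM.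
exists l, N; split; first by split.
have l0 : (0 < l)%N.
  rewrite lt0n; apply/negP => /eqP l0; apply: M0 => m; apply: N0.
  by rewrite -l0; exact: Nl.
have [_ N1] := layer N 0%N N0 (NS _ l0).
have Nmono j k : (j <= k)%N -> (k <= l)%N -> submodule_le (N j) (N k).
  elim: k => [|k IH]; first by rewrite leqn0 => /eqP -> _ x.
  rewrite leq_eqVlt => /orP [/eqP -> _ x //|jk] kl x xN.
  by apply: Nle => //; apply: IH => //; exact: ltnW.
(* Only the bottom layer counts: [e i] maps [M] into [N 1], so every later layer is dead at [i]. *)
rewrite -(cards1 (Ordinal l0)) -cardsE; apply: eq_card => k; rewrite !inE.
apply/asboolP/eqP => [kE|->].
  apply: val_inj => /=; apply/eqP; rewrite -leqn0 leqNgt; apply/negP => k0.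
  apply: (iso_Emod_not_dead finA he kE); apply/factor_dead => x _.
  by apply: (Nmono 1%N) => //; [exact: ltnW | apply/N1; exact: ME].
apply: (simple_iso_Emod finA he); first exact: NS.
move=> /factor_dead d0; have [y iy] := socle_nonzero i.
apply: (Emod_not_dead finA he (i := i)) => y'; apply: (@socle_inj i).
have [x0 x00] : exists x : M, x <> 0.
  by apply: contrapT => nx; apply: M0 => m; apply: contrapT => m0; apply: nx; exists m.
have [m _ um] := ess (fun=> True) x0 (closed_all M) Logic.I x00 y'.
rewrite linear0 linearZ /= -um -linearZ /= (N0 (e i *: m)) ?linear0 //.
by apply: d0; apply/N1; exists y'.
Qed.

Lemma submod_dead l V (W : submodule V) :
  dead e l (submod W) <-> forall x, x \in W -> e l *: x = 0.
Proof.
split=> [dW x xW|dW x]; last by apply: val_inj; exact: dW (valP x).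
by have /(congr1 val) := dW (exist _ x xW).
Qed.

(** Quantifying over [a] tests the whole submodule generated by [x]. The predicate cuts out
    nabla(i), and [socle_pred] cuts out the largest submodule that [e i] maps into the socle. *)
Definition nabla_pred i (x : I i) : Prop :=
  forall (l : 'I_n) a, (i < l)%N -> e l *: (a *: x) = 0.

Definition socle_pred i (x : I i) : Prop :=
  forall a, exists y, socle i y = e i *: (a *: x).

Lemma nabla_closed i : lin_closed (@nabla_pred i).
Proof.
split=> [l a _|a x y xN yN l b il]; first by rewrite !scaler0.
by rewrite scalerDr scalerA scalerDr xN // yN // addr0.
Qed.

Lemma socle_closed i : lin_closed (@socle_pred i).
Proof.
split=> [a|a x y xN yN b]; first by exists 0; rewrite linear0 !scaler0.
have [[x' x'E] [y' y'E]] := (xN (b * a), yN b).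
by exists (x' + y'); rewrite linearD x'E y'E scalerDr scalerA scalerDr.
Qed.

Lemma socle_nabla i y : nabla_pred (socle i y).
Proof.
move=> l a il; rewrite -!linearZ /= (Emod_dead finA he hbasic) ?linear0 //.
by apply/eqP => il'; rewrite il' ltnn in il.
Qed.

Lemma socle_in_socle i y : socle_pred (socle i y).
Proof. by move=> a; exists (e i *: (a *: y)); rewrite !linearZ. Qed.

Lemma submod_fin V (W : submodule V) : fin V -> fin (submod W).
Proof.
have [g gE] := submod_emb W.
by apply: (fin_inj (f := g)) => x y; rewrite !gE => /val_inj.
Qed.

Lemma costandardP i (N : submodule (I i)) :
  costandard e N <-> forall x, x \in N <-> nabla_pred x.
Proof.
have finW (W : submodule (I i)) : fin (submod W) by apply: submod_fin; exact: I_fin.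
have le_nabla (W : submodule (I i)) : no_factor_above e i (submod W) -> forall x, x \in W -> nabla_pred x.
  move=> /(no_factor_aboveP finA he _ (finW W)) dW x xW l a il.
  by apply: (submod_dead _ _).1 (dW l il) _ _; rewrite rpredZ.
have nablaW (W : submodule (I i)) : (forall x, x \in W <-> nabla_pred x) ->
    no_factor_above e i (submod W).
  move=> WE; apply/(no_factor_aboveP finA he _ (finW W)) => l il.
  by apply/submod_dead => x /WE xW; rewrite -[x]scale1r; exact: xW.
split=> [[nN Nmax] x|NE].
  split=> [|xN]; first exact: le_nabla.
  have [W WE] := ex_submodule (@nabla_closed i).
  by apply: (Nmax W); [exact: nablaW | apply/WE].
by split=> [|W nW x xW]; [exact: nablaW | apply/NE; exact: le_nabla xW].
Qed.

Lemma proper_greatestP i (N : submodule (I i)) (L : submodule (submod N)) :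
  (forall x, x \in N <-> nabla_pred x) ->
  is_greatest_submodule (fun W : submodule (submod N) => multiplicity (submod W) (Emod e i) 1) L <->
  forall w, w \in L <-> socle_pred (val w).
Proof.
move=> NE; have [u uE] := submod_emb N.
have u_inj : injective u by move=> x y; rewrite !uE => /val_inj.
have multE (W : submodule (submod N)) : multiplicity (submod W) (Emod e i) 1 <->
    (exists w, w \in W /\ w <> 0) /\
    forall w, w \in W -> exists y, socle i y = e i *: (val w : I i).
  have [g gE] := submod_emb W.
  have g_inj : injective g by move=> x y; rewrite !gE => /val_inj.
  rewrite (@multiplicity1P i (submod W) (u \o g)); last 2 first.
  - by apply: submod_fin; apply: submod_fin; exact: I_fin.
  - exact: inj_comp.
  split=> [[W0 Ws]|[[w [wW w0]] Ws]]; split.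
  - apply: contrapT => nw; apply: W0 => w; apply: val_inj; apply: contrapT => w0.
    by apply: nw; exists (val w); split=> //; exact: valP.
  - move=> w wW; have [y yE] := Ws (exist _ w wW).
    by exists y; rewrite yE linearZ /= gE uE.
  - by move=> W0; apply: w0; have /(congr1 val) := W0 (exist _ w wW).
  - move=> m; have [y yE] := Ws (val m) (valP m).
    by exists y; rewrite yE linearZ /= gE uE.
have cS : lin_closed (fun w : submod N => socle_pred (val w)).
  split=> [|a x y xS yS]; first by case: (@socle_closed i).
  by case: (@socle_closed i) => _; apply.
have mult_le (W : submodule (submod N)) : multiplicity (submod W) (Emod e i) 1 ->
    forall w, w \in W -> socle_pred (val w).
  move=> /multE [_ Ws] w wW a; apply: (Ws (a *: w)).
  by rewrite rpredZ.
have multS (W : submodule (submod N)) : (forall w, w \in W <-> socle_pred (val w)) ->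
    multiplicity (submod W) (Emod e i) 1.
  move=> WE; apply/multE; split; last first.
    by move=> w /WE /(_ 1) [y yE]; exists y; rewrite yE scale1r.
  have [y iy] := socle_nonzero i; have yN : socle i y \in N by apply/NE; exact: socle_nabla.
  exists (exist _ (socle i y) yN); split; first by apply/WE; exact: socle_in_socle.
  by move=> /(congr1 val).
split=> [[mL Lmax] w|LE].
  split=> [|wS]; first exact: mult_le.
  have [W WE] := ex_submodule cS.
  by apply: (Lmax W); [exact: multS | apply/WE].
by split=> [|W mW x xW]; [exact: multS | apply/LE; exact: mult_le xW].
Qed.

(** The proper costandard module up to isomorphism, flattened from a submodule of a submodule to a
    single embedding into I(i). *)
Definition nabbar_emb i X (g : {linear X -> I i}) : Prop :=
  injective g /\ forall x, (nabla_pred x /\ socle_pred x) <-> exists z, g z = x.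

Lemma submod2_emb i (N : submodule (I i)) (L : submodule (submod N)) :
  (forall x, x \in N <-> nabla_pred x) -> (forall w, w \in L <-> socle_pred (val w)) ->
  exists g : {linear submod L -> I i}, nabbar_emb g.
Proof.
move=> NE LE; have [u uE] := submod_emb N; have [v vE] := submod_emb L.
exists (u \o v); split=> [x y /=|x]; first by rewrite !uE !vE => /val_inj /val_inj.
split=> [[/NE xN xS]|[z <-]]; last first.
  by rewrite /= uE vE; split; [apply/NE/(valP (val z)) | apply/LE/(valP z)].
have xL : exist _ x xN \in L by apply/LE.
by exists (exist _ (exist _ x xN) xL); rewrite /= uE vE.
Qed.

Lemma proper_costandardP i X : proper_costandard e I i X ->
  exists g : {linear X -> I i}, nabbar_emb g.
Proof.
case=> N /costandardP NE [L /(proper_greatestP _ NE) LE ->].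
exact: submod2_emb NE LE.
Qed.

Lemma ex_proper_costandard i : exists X (g : {linear X -> I i}),
  nabbar_emb g /\ nablabar e I X.
Proof.
have [N NE] := ex_submodule (@nabla_closed i); have [u uE] := submod_emb N.
have [L LE] := ex_submodule (closed_preim u (@socle_closed i)).
have {}LE w : w \in L <-> socle_pred (val w) by rewrite LE uE.
have [g gN] := submod2_emb NE LE; exists (submod L), g; split=> //.
exists i, N; first exact/costandardP.
by exists L => //; exact/proper_greatestP.
Qed.

Lemma nablabarP X : nablabar e I X -> exists i (g : {linear X -> I i}), nabbar_emb g.
Proof. by case=> i /proper_costandardP [g gX]; exists i, g. Qed.

Lemma nabbar_fin i X (g : {linear X -> I i}) : nabbar_emb g -> fin X.
Proof. by case=> g_inj _; apply: fin_inj g_inj _; exact: I_fin. Qed.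

Lemma nabbar_dead i X (g : {linear X -> I i}) (l : 'I_n) : nabbar_emb g ->
  (i < l)%N -> dead e l X.
Proof.
move=> [g_inj gE] il x; apply: (inj_eq0 g_inj); rewrite linearZ /=.
have [xN _] : nabla_pred (g x) /\ socle_pred (g x) by apply/gE; exists x.
by rewrite -[g x]scale1r; exact: xN.
Qed.

Lemma nabbar_socle i X (g : {linear X -> I i}) x : nabbar_emb g ->
  exists y, socle i y = g (e i *: x).
Proof.
move=> [g_inj gE].
have [_ xS] : nabla_pred (g x) /\ socle_pred (g x) by apply/gE; exists x.
by have [y yE] := xS 1; exists y; rewrite yE scale1r linearZ.
Qed.

Lemma nabbar_socle_emb i X (g : {linear X -> I i}) : nabbar_emb g ->
  exists k : {linear Emod e i -> X}, [/\ injective k, forall y, g (k y) = socle i y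
    & forall (P : X -> Prop) x, lin_closed P -> P x -> x <> 0 -> forall y, P (k y)].
Proof.
move=> [g_inj gE]; have [|k kE] := corestrict (g := g) (h := socle i) g_inj.
  by move=> y; apply/gE; split; [exact: socle_nabla | exact: socle_in_socle].
exists k; split=> // [y y' /(congr1 g)|P x cP Px x0 y]; first by rewrite !kE => /socle_inj.
have [] := @socle_essential i (fun v => exists2 m, P m & g m = v) (g x) _ _ _ y.
- exact: closed_im.
- by exists x.
- by move=> /(inj_eq0 g_inj).
by move=> m Pm; rewrite -kE => /g_inj <-.
Qed.

Notation D := (Dmod finA he).

(** For [i <= j], [X] has no factor above [j]. For [j < i], extend [f] into I(i): as Delta(j) is
    dead above [j], [e l] maps [M] into [Z] for [l > j]. The two conditions defining nablabar(i)
    involve only [e l] with [l >= i], so the extension takes values in nablabar(i). *)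
Lemma ext0_Dmod_nabbar i j X (g : {linear X -> I i}) : nabbar_emb g -> ext0 (D j) X.
Proof.
move=> gX; have [ij|ji] := leqP i j.
  apply: ext0_Dmod_dead => l jl; apply: (nabbar_dead gX); exact: leq_ltn_trans jl.
have [g_inj gE] := gX; move=> Z M k p kp f; have [k_inj p_surj kpE] := kp.
have [h hE] := I_injective (g \o f : {linear Z -> I i}) k_inj.
have hk (l : 'I_n) x : (j < l)%N -> exists z, h (e l *: x) = g (f (e l *: z)).
  move=> jl; have /kpE [z zE] : p (e l *: x) = 0 by rewrite linearZ /= Dmod_dead.
  by exists z; rewrite -(e_idemZ he) -zE -linearZ /= hE.
have [|h' h'E] := corestrict (g := g) (h := h) g_inj; last first.
  by exists h' => z; apply: g_inj; rewrite h'E hE.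
move=> x; apply/gE; split=> [l a il|a].
  rewrite -!linearZ /=; have [z ->] := hk l (a *: x) (ltn_trans ji il).
  by rewrite linearZ /= (nabbar_dead gX il) linear0.
rewrite -!linearZ /=; have [z ->] := hk i (a *: x) ji.
by rewrite linearZ /=; exact: nabbar_socle gX.
Qed.

Lemma ext0_Dmod_filt_nablabar j Y : filt (nablabar e I) Y -> ext0 (D j) Y.
Proof.
apply: ext0_filt_r; first exact: Dmod_presented.
by move=> X /nablabarP [i [g gX]]; exact: ext0_Dmod_nabbar gX.
Qed.

End ProperCostandardModules.

(** * Modules with a good filtration *)

Section GoodFiltrations.
Context {A : nzRingType} {n : nat} (e : 'I_n -> A) (I : 'I_n -> lmodType A).
Hypothesis finA : fin A^o.
Hypothesis he : complete_primitive_orthogonal e.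
Hypothesis hbasic : basic_algebra e.
Hypothesis hI : forall i, fin_gen (I i) /\ injective_envelope (Emod e i) (I i).
Hypothesis hstrat : standardly_stratified e.
Implicit Types V W X Y Z M N P S Q C U L : lmodType A.
Notation D := (Dmod finA he).

Definition Dperp Y : Prop := forall j, ext0 (D j) Y.

Lemma Dperp_quotient Y M X (g : {linear Y -> M}) (p : {linear M -> X}) :
  ses g p -> Dperp Y -> Dperp M -> Dperp X.
Proof.
move=> gp pY pM j; have [Z [P [k [q [projP _ kq eZ]]]]] := Dmod_syzygy finA he hstrat j.
by apply: (ext0_cosyzygy projP kq gp) => //; exact: eZ.
Qed.

Lemma ext0_Delta_filt X Y : Dperp Y -> filt (Delta e) X -> ext0 X Y.
Proof.
move=> pY; apply: ext0_filt_l => Z /(Delta_iso finA he) [i iZ].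
exact: ext0_iso_l iZ (pY i).
Qed.

Lemma not_dead_exists S : ~ is_zero S -> exists i, ~ dead e i S.
Proof. by move=> /(e_nonzero he) [i [m em]]; exists i => /(_ m). Qed.

Lemma nabbar_sub Y : fin Y -> Dperp Y -> ~ is_zero Y ->
  exists X (k : {linear X -> Y}), [/\ nablabar e I X, injective k, Dperp X & ~ is_zero X].
Proof.
move=> finY pY Y0.
pose P m := `[< exists i : 'I_n, i = m :> nat /\
  exists f : {linear Emod e i -> Y}, injective f >].
have simple_sub S (f : {linear S -> Y}) i : injective f -> simple_module S ->
    ~ dead e i S -> P i.
  move=> f_inj simpS /(simple_iso_Emod finA he simpS) /iso_mapP [u [v [uK vK]]].
  apply/asboolP; exists i; split=> //; exists (f \o v).
  exact: inj_comp f_inj (can_inj vK).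
have exP : exists m, P m.
  have [S [f [f_inj simpS]]] := nonzero_simple_sub (finY false) Y0.
  have /not_dead_exists [i ndS] : ~ is_zero S by case/simple_moduleP: simpS.
  by exists i; exact: simple_sub f_inj simpS ndS.
case: (ex_minnP exP) => m /asboolP [i [<- [f f_inj]]] imin.
(* A simple submodule of the image of [h] would be some E(l) with [l < i] inside [Y], against the
   minimality of [i]. *)
have hom0 U (h : {linear U -> Y}) :
    (forall l : 'I_n, (i <= l)%N -> dead e l U) -> forall x, h x = 0.
  move=> dU; have [Z [g [p [g_inj p_surj pE]]]] := im_module h.
  suff Z0 : is_zero Z by move=> x; rewrite -pE (Z0 (p x)) linear0.
  apply: contrapT => nZ0.
  have [S [k [k_inj simpS]]] := nonzero_simple_sub (extremal_inj g_inj (finY false)) nZ0.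
  have /not_dead_exists [l ndS] : ~ is_zero S by case/simple_moduleP: simpS.
  have gk_inj : injective (g \o k : {linear S -> Y}) by exact: inj_comp.
  have il := imin _ (simple_sub S _ l gk_inj simpS ndS).
  by apply: ndS; apply: dead_inj k_inj _; apply: dead_surj p_surj _; exact: dU.
(* The kernel [U] of Delta(j) -> E(j) only has factors E(l) with [l <= j < i]; hence Hom(U, Y) = 0,
   and Ext^1 passes from Delta(j) to E(j). *)
have extE (j : 'I_n) : (j < i)%N -> ext0 (Emod e j) Y.
  move=> ji; have [q [q_surj qE]] := Emod_proj finA he j.
  have [r [r_surj rE]] := Dmod_proj finA he j.
  have [|t tE] := @factor_surj _ _ _ _ r q r_surj.
    move=> x /rE trx; apply: (tr_dead (e := e) (j := j)); last exact: tr_map.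
    move=> l jl; apply: (Emod_dead finA he hbasic).
    by apply/eqP => jl'; rewrite jl' ltnn in jl.
  have t_surj : surj t by move=> y; have [x <-] := q_surj y; exists (r x).
  have [U [k kt]] := ses_ker t_surj; apply: (ext0_quotient kt (pY j)) => h.
  apply: hom0 => l il; have [k_inj _ _] := kt; apply: dead_inj k_inj _.
  by apply: Dmod_dead; exact: leq_trans il.
have extC C : filt simple_module C ->
    (forall l : 'I_n, (i <= l)%N -> dead e l C) -> ext0 C Y.
  elim=> {C} [C C0|Z C S g p gp _ IH simpS] dC.
    by apply: ext0_proj; exact: projective_zero.
  have [g_inj p_surj _] := gp; apply: (ext0_middle_l gp).
    by apply: IH => l il; apply: dead_inj g_inj _; exact: dC.
  have /not_dead_exists [l ndS] : ~ is_zero S by case/simple_moduleP: simpS.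
  have SE := simple_iso_Emod finA he simpS ndS.
  apply: ext0_iso_l (iso_sym SE) _; apply: extE; rewrite ltnNge; apply/negP => il.
  by apply: ndS; apply: dead_surj p_surj _; exact: dC.
have [X [g [gX nX]]] := ex_proper_costandard finA he hbasic hI i.
have [k [k_inj gk kess]] := nabbar_socle_emb finA he hbasic gX.
have E0 : ~ is_zero (Emod e i) by case/simple_moduleP: (Emod_simple finA he i).
(* [C] is nablabar(i) modulo its socle E(i), so its factors are all E(l) with [l < i]. *)
have [C [p kp]] := ses_coker k_inj; have [_ p_surj kpE] := kp.
have eC : ext0 C Y.
  apply: extC => [|l]; first exact: fin_filt_simple (fin_surj p_surj (nabbar_fin finA gX)).
  rewrite leq_eqVlt => /orP [/eqP/val_inj <-|il].
    move=> c; have [x <-] := p_surj c; rewrite -linearZ /=; apply/kpE.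
    have [y yE] := nabbar_socle x gX; exists y.
    by case: gX => g_inj _; apply: g_inj; rewrite gk.
  by apply: dead_surj p_surj _; exact: nabbar_dead gX il.
have [h hE] := eC _ _ _ _ kp f.
exists X, h; split=> //.
(* A nonzero kernel of [h] would contain the socle, on which [h] is the embedding [f]. *)
- apply: inj_lin => x hx; apply: contrapT => x0; apply: E0 => y.
  apply: (inj_eq0 f_inj); rewrite -hE.
  exact: (kess (fun x => h x = 0) x (closed_preim h (closed_zero Y))).
- by move=> j; exact: ext0_Dmod_nabbar gX.
- by move=> X0; apply: E0 => y; apply: (inj_eq0 k_inj); exact: X0.
Qed.

Lemma filt_nablabar Y : fin Y -> Dperp Y -> filt (nablabar e I) Y.
Proof.
move: Y; apply: quotient_ind => Y finY IH pY.
have [Y0|Y0] := pselect (is_zero Y); first exact: Filt0.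
have [X [k [nX k_inj pX X0]]] := nabbar_sub finY pY Y0.
have [C [p kp]] := ses_coker k_inj; have [_ p_surj _] := kp.
apply: (filt_ses kp (filt_one nX)).
apply: (IH _ p p_surj); last exact: Dperp_quotient kp pX pY.
move=> p_inj; apply: X0 => x; apply: (inj_eq0 k_inj); apply: (inj_eq0 p_inj).
exact: ses0 kp.
Qed.

Lemma filt_nablabar_Dperp Y : filt (nablabar e I) Y -> Dperp Y.
Proof. by move=> FY j; exact: (ext0_Dmod_filt_nablabar (I := I)). Qed.

Lemma filt_nablabar_fin Y : filt (nablabar e I) Y -> fin Y.
Proof. by apply: fin_filt => X /(nablabarP finA he hbasic hI) [i [g gX]]; exact: nabbar_fin gX. Qed.

(** * Enough injectives and projectives; dimension shifting *)

Lemma enough_injectives X : fin X -> exists Q Y (g : {linear X -> Q}) (p : {linear Q -> Y}),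
  [/\ ses g p, injective_module Q, fin Q & fin Y].
Proof.
move=> finX; suff: exists Q (g : {linear X -> Q}), [/\ injective g, injective_module Q & fin Q].
  move=> [Q [g [g_inj injQ finQ]]]; have [Y [p gp]] := ses_coker g_inj.
  by exists Q, Y, g, p; split=> //; case: gp => _ p_surj _; exact: fin_surj p_surj finQ.
move: X finX; apply: quotient_ind => X finX IH.
have [X0|X0] := pselect (is_zero X).
  by exists X, (idfun : {linear X -> X}); split=> //; exact: injective_zero.
have [S [k [k_inj simpS]]] := nonzero_simple_sub (finX false) X0.
have S0 : ~ is_zero S by case/simple_moduleP: simpS.
have [i ndS] := not_dead_exists S0.
have [u [v [uK vK]]] := iso_mapP (simple_iso_Emod finA he simpS ndS).
have [Y [p kp]] := ses_coker k_inj; have [_ p_surj kpE] := kp.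
have [|Q [g [g_inj injQ finQ]]] := IH Y p p_surj.
  move=> p_inj; apply: S0 => s; apply: (inj_eq0 k_inj); apply: (inj_eq0 p_inj).
  exact: ses0 kp.
(* [h] is injective on [S], and [g \o p] has kernel [S]; together they embed [X]. *)
have [h hE] := I_injective hI (socle hI i \o u : {linear S -> I i}) k_inj.
have [t tE] := pair_lin h (g \o p : {linear X -> Q}).
exists (I i * Q)%type, t; split; last 2 first.
- by apply: injective_prod => //; exact: I_injective.
- by apply: fin_prod => //; exact: I_fin.
apply: inj_lin => x; rewrite tE => -[hx /(inj_eq0 g_inj) /kpE [s sE]].
move: hx; rewrite -sE hE /= => /(inj_eq0 (@socle_inj _ _ _ _ hI i)) /(inj_eq0 (can_inj uK)) ->.
exact: linear0.
Qed.

Lemma enough_projectives X : fin X -> exists P Y (g : {linear Y -> P}) (p : {linear P -> X}),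
  [/\ ses g p, projective P, fin P & fin Y].
Proof.
move=> finX; suff: exists P (p : {linear P -> X}), [/\ surj p, projective P & fin P].
  move=> [P [p [p_surj projP finP]]]; have [Y [g gp]] := ses_ker p_surj.
  by exists P, Y, g, p; split=> //; case: gp => g_inj _ _; exact: fin_inj g_inj finP.
have [m [x xX]] := fin_gen_fin finX.
suff [P [p [pE projP finP]]] : exists P (p : {linear P -> X}),
    [/\ forall c : 'I_m -> A, exists y, p y = \sum_(i < m) c i *: x i, projective P & fin P].
  exists P, p; split=> // y; have [c ->] := xX y; exact: pE.
elim: m x {xX} => [|m IH] x.
  have [Z Z0] := @ex_zero_module A; have [p pE] := lin_zero Z X.
  exists Z, p; split; [|exact: projective_zero|exact: fin_zero] => c.
  by exists 0; rewrite big_ord0 linear0.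
have [P [p [pE projP finP]]] := IH (fun i => x (lift ord0 i)).
have [f fE] := scale_lin (x ord0).
have [q qE] := lin_add (f \o fst : {linear (A^o * P)%type -> X})
                       (p \o snd : {linear (A^o * P)%type -> X}).
exists (A^o * P)%type, q; split; last exact: fin_prod.
  move=> c; have [y yE] := pE (fun i => c (lift ord0 i)).
  by exists (c ord0 : A^o, y); rewrite qE big_ord_recl /= fE yE.
apply: projective_prod => // M N g h g_surj; have [w wE] := g_surj (h 1).
have [k kE] := scale_lin w; exists k => a.
by rewrite kE linearZ /= wE -linearZ /=; congr (h _); rewrite -[RHS]mulr1.
Qed.

(** The starting module is left implicit and the injectives need not be envelopes. *)
Fixpoint cosyzygy m Z : Prop :=
  if m is m'.+1 then exists Z' Q (g : {linear Z' -> Q}) (p : {linear Q -> Z}),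
    [/\ cosyzygy m' Z', injective_module Q, fin Q & ses g p]
  else fin Z.

Lemma cosyzygy_fin m Z : cosyzygy m Z -> fin Z.
Proof. by case: m => [//|m] [Z' [Q [g [p [_ _ finQ [_ p_surj _]]]]]]; exact: fin_surj p_surj finQ. Qed.

Lemma cosyzygyS m Z : cosyzygy m Z -> exists Z' Q (g : {linear Z -> Q}) (p : {linear Q -> Z'}),
  [/\ cosyzygy m.+1 Z', injective_module Q, fin Q & ses g p].
Proof.
move=> cZ; have [Q [Y [g [p [gp injQ finQ finY]]]]] := enough_injectives (cosyzygy_fin cZ).
by exists Y, Q, g, p; split=> //; exists Z, Q, g, p.
Qed.

(** Ext^1(X, Z) is Ext^(m+1) of [X] against the start of the cosyzygy sequence, which vanishes for
    [m >= d]. *)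
Lemma ext0_resolution_cosyzygy X d m Z : projective_resolution X d -> (d <= m)%N ->
  cosyzygy m Z -> ext0 X Z.
Proof.
elim: d X m Z => [|d IH] X m Z.
  by move=> /projective_resolution0_inv projX _ _; exact: ext0_proj.
move=> /projective_resolutionS_inv [N [P [k [q [kq projP resN]]]]].
case: m => // m dm [Z' [Q [g [p [cZ' injQ _ gp]]]]].
by apply: (ext0_cosyzygy projP kq gp); [exact: ext0_inj | exact: IH cZ'].
Qed.

(** The finiteness of proj.dim Delta(j), in the form used later: each syzygy raises the index by at
    least one and uses up one cosyzygy. With the bound [n <= m + j] the case [m = 0] is vacuous. *)
Lemma ext0_Dmod_cosyzygy m (j : 'I_n) Z : (n <= m + j)%N -> cosyzygy m Z -> ext0 (D j) Z.
Proof.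
elim: m j Z => [|m IH] j Z; first by rewrite leqNgt ltn_ord.
move=> nj [Z' [Q [g [p [cZ' injQ _ gp]]]]].
have [N [P [k [q [projP _ kq eN]]]]] := Dmod_syzygy finA he hstrat j.
apply: (ext0_cosyzygy projP kq gp); first exact: ext0_inj.
apply: eN => l jl; apply: IH cZ'; apply: leq_trans nj _.
by rewrite addSnnS leq_add2l.
Qed.

Inductive syzygy : nat -> lmodType A -> lmodType A -> Prop :=
| Syzygy0 X : syzygy 0 X X
| SyzygyS d X L P N (k : {linear N -> P}) (q : {linear P -> L}) of
    syzygy d X L & projective P & ses k q & fin P : syzygy d.+1 X N.

Lemma syzygy_exists d X : fin X -> exists2 L, syzygy d X L & fin L.
Proof.
move=> finX; elim: d => [|d [L sL finL]]; first by exists X => //; exact: Syzygy0.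
have [P [N [k [q [kq projP finP finN]]]]] := enough_projectives finL.
by exists N => //; exact: SyzygyS sL projP kq finP.
Qed.

Lemma syzygy_resolution d X L d' : syzygy d X L -> projective_resolution L d' ->
  projective_resolution X (d + d').
Proof.
move=> sL; elim: sL d' => {d X L} [X d' //|d X L P N k q _ IH projP kq _ d' resN].
by rewrite addSnnS; apply: IH; exact: projective_resolutionS kq projP resN.
Qed.

Definition Nperp X : Prop := forall Y, fin Y -> Dperp Y -> ext0 X Y.

Lemma Dperp_injective Q : injective_module Q -> Dperp Q.
Proof. by move=> injQ j; exact: ext0_inj. Qed.

(** Ext^1(N, Y) = Ext^2(L, Y) = Ext^1(L, Z) for the cosyzygy [Z] of [Y], which is again in
    [Dperp]. *)
Lemma Nperp_syzygy d X L : Nperp X -> syzygy d X L -> Nperp L.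
Proof.
move=> NX sL; elim: sL NX => {d X L} [X //|d X L P N k q _ IH projP kq finP] /IH NL.
move=> Y finY pY; have [Q [Z [g [p [gp injQ finQ finZ]]]]] := enough_injectives finY.
apply: (ext0_syzygy kq gp); [exact: ext0_inj | exact: ext0_proj |].
by apply: NL => //; apply: Dperp_quotient gp pY _; exact: Dperp_injective.
Qed.

(** Each step trades one syzygy of [X] for one term of the coresolution of [Z]. *)
Lemma ext0_syzygy_coresolution d X L Z : Nperp X -> syzygy d X L -> fin Z ->
  coresolution (filt (nablabar e I)) Z d -> ext0 L Z.
Proof.
move=> NX sL; elim: sL NX Z => {d X L} [X|d X L P N k q sL IH projP kq finP] NX Z finZ.
  move=> /coresolution0_inv [M FM ZM]; apply: NX => //.
  by move=> j; apply: ext0_iso_r (iso_sym ZM) _; exact: filt_nablabar_Dperp.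
move=> /coresolutionS_inv [M [Z1 [g [p [gp FM cZ1]]]]].
have finM := filt_nablabar_fin FM.
have NN : Nperp N by apply: Nperp_syzygy NX _; exact: SyzygyS sL projP kq finP.
apply: (ext0_syzygy kq gp).
- by apply: NN => //; exact: filt_nablabar_Dperp.
- exact: ext0_proj.
by apply: IH => //; case: gp => _ p_surj _; exact: fin_surj p_surj finM.
Qed.

(** The test module is the next syzygy [N]: Ext^1(L, N) = 0 splits the projective cover sequence of
    the [s]-th syzygy [L]. *)
Lemma resolution_of_bound s X : Nperp X -> fin X ->
  (forall Z, fin Z -> coresolution (filt (nablabar e I)) Z s) ->
  projective_resolution X s.
Proof.
move=> NX finX bound; have [L sL finL] := syzygy_exists s finX.
rewrite -[s]addn0; apply: (syzygy_resolution sL); apply: projective_resolution0.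
have [P [N [k [q [kq projP finP finN]]]]] := enough_projectives finL.
apply: (projective_of_ext0 projP kq).
exact: ext0_syzygy_coresolution NX sL finN (bound _ finN).
Qed.
End GoodFiltrations.

(** * Universal extensions *)

Lemma ext0_ffun {K : pzRingType} (T Z : lmodType K) m :
  ext0 T Z -> ext0 ({ffun 'I_m -> T} : lmodType K) Z.
Proof.
move=> eT; elim: m => [|m IH].
  by apply: ext0_proj; apply: projective_zero => u; apply/ffunP; case.
have [|g gE] := @ex_lin _ T {ffun 'I_m.+1 -> T}
    (fun t => [ffun i => if unlift ord0 i is Some _ then 0 else t]).
  move=> a x y; apply/ffunP => i; rewrite !ffunE; case: unlift => // _.
  by rewrite scaler0 addr0.
have [|p pE] := @ex_lin _ {ffun 'I_m.+1 -> T} {ffun 'I_m -> T}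
    (fun u => [ffun i => u (lift ord0 i)]).
  by move=> a x y; apply/ffunP => i; rewrite !ffunE.
apply: (ext0_middle_l (i := g) (q := p)) => //; split=> [x y|u|u].
- by rewrite !gE => /ffunP /(_ ord0); rewrite !ffunE unlift_none.
- exists [ffun i => if unlift ord0 i is Some j then u j else 0].
  by rewrite pE; apply/ffunP => i; rewrite !ffunE liftK.
rewrite pE; split=> [/ffunP pu|[t <-]]; last first.
  by rewrite gE; apply/ffunP => i; rewrite !ffunE liftK.
exists (u ord0); rewrite gE; apply/ffunP => i; rewrite ffunE.
by case: unliftP => [j ->|-> //]; have := pu j; rewrite !ffunE.
Qed.

Lemma ext0_add_class {K : pzRingType} (T M Z : lmodType K) :
  add_class T M -> ext0 T Z -> ext0 M Z.
Proof.
case=> m [N /iso_mapP [f [g [fK gK]]]] /(@ext0_ffun _ _ _ m) eTm.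
have [i [p [_ iE _]]] := ses_prod M N.
apply: (ext0_retract (a := f \o i) (b := fst \o g)) eTm => x.
by rewrite /= fK iE.
Qed.

Lemma add_class_refl {K : pzRingType} (T : lmodType K) : add_class T T.
Proof.
have [Z Z0] := @ex_zero_module K; exists 1%N, Z.
have [|f fE] := @ex_lin _ (T * Z)%type {ffun 'I_1 -> T} (fun x => [ffun=> x.1]).
  by move=> a x y; apply/ffunP => i; rewrite !ffunE.
apply: (isoE (f := f)) => [[t z] [t' z']|u].
  by rewrite !fE => /ffunP /(_ ord0); rewrite !ffunE (Z0 z) (Z0 z') /= => ->.
by exists (u ord0, 0); rewrite fE; apply/ffunP => i; rewrite ffunE (ord1 i).
Qed.

Section UniversalExtensions.
Context {R : comNzRingType} {A : algType R} {n : nat} (e : 'I_n -> A).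
Hypothesis artA : artin_algebra A.
Hypothesis finA : fin A^o.
Hypothesis he : complete_primitive_orthogonal e.
Hypothesis hstrat : standardly_stratified e.
Implicit Types V W X Y Z M N P S Q C U L : lmodType A.
Notation D := (Dmod finA he).

(** Each [f i] is pushed out along the same sequence, which adds one layer [X]; maps already
    extended stay extended after composing with the next embedding. *)
Lemma extend_maps N P X Y (k : {linear N -> P}) (q : {linear P -> X}) m
    (f : 'I_m -> {linear N -> Y}) : ses k q ->
  exists Y' X' (g : {linear Y -> Y'}) (p : {linear Y' -> X'}),
    [/\ ses g p, filt (eq X) X' &
      forall i, exists h : {linear P -> Y'}, forall x, h (k x) = g (f i x)].
Proof.
move=> kq; elim: m f => [|m IH] f.
  have [Z [p [gp Z0]]] := ses_zero_r Y.
  by exists Y, Z, (idfun : {linear Y -> Y}), p; split=> //; [exact: Filt0 | case].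
have [Y1 [X1 [g1 [p1 [gp1 FX1 fE]]]]] := IH (fun i => f (lift ord0 i)).
have [E [g2 [p2 [c [gp2 cE _]]]]] := ses_pushout (g1 \o f ord0 : {linear N -> Y1}) kq.
have [X' [p' [i [r [gp' ir]]]]] := ses_comp gp1 gp2.
exists E, X', (g2 \o g1), p'; split=> //.
  by apply: FiltS ir FX1 (erefl X).
move=> j; case: (unliftP ord0 j) => [j' ->|->]; last first.
  by exists c => x; rewrite cE.
have [h hE] := fE j'; exists (g2 \o h) => x.
by rewrite /= hE.
Qed.

Lemma filt_Dmod_dead j (l : 'I_n) X : filt (eq (D j)) X -> (j < l)%N -> dead e l X.
Proof.
move=> FX jl; elim: FX => {X} [X X0 x|Z M X g p gp _ dZ DX]; first exact: X0.
by apply: (dead_ses he gp dZ); rewrite -DX; exact: Dmod_dead.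
Qed.

(** Let [u] map the syzygy [N] to [Y']. Its image in [X'] extends to [P], because Ext^1(Delta(j),
    X') = 0; after subtracting a lift [w], what remains takes values in [Y] and is an
    [R]-combination of the [f i], all of which were made extendable. *)
Lemma universal_extension_step (j : 'I_n) Y : fin Y ->
  exists Y' X' (g : {linear Y -> Y'}) (p : {linear Y' -> X'}),
    [/\ ses g p, filt (eq (D j)) X' & ext0 (D j) Y'].
Proof.
move=> finY; have [N [P [k [q [projP finP kq _]]]]] := Dmod_syzygy finA he hstrat j.
have finN : fin N by case: kq => k_inj _ _; exact: fin_inj k_inj finP.
have [m [f fE]] := hom_fin_gen artA finN finY.
have [Y' [X' [g [p [gp FX' hE]]]]] := extend_maps f kq.
exists Y', X', g, p; split=> //; apply: (ext0_pres projP kq) => u.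
have eX' : ext0 (D j) X'.
  by apply: ext0_Dmod_dead => l jl; exact: filt_Dmod_dead FX' jl.
have [v vE] := eX' _ _ _ _ kq (p \o u : {linear N -> X'}).
have [g_inj p_surj gpE] := gp.
have [w wE] := projP _ _ p v p_surj.
have [d dE] := lin_sub u (w \o k : {linear N -> Y'}).
have [|t tE] := corestrict (g := g) (h := d) g_inj.
  by move=> x; apply/gpE; rewrite dE linearB /= wE vE subrr.
have [c cE] := fE t; have [h hhE] := choice hE.
have [|s sE] := @ex_lin _ P Y' (fun x => \sum_(i < m) (c i)%:A *: h i x).
  move=> a x y; rewrite scaler_sumr -big_split; apply: eq_bigr => i _ /=.
  by rewrite linearP scalerDr !scalerA mulr_algl mulr_algr.
have [r rE] := lin_add s w; exists r => x; rewrite rE sE.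
have -> : \sum_(i < m) (c i)%:A *: h i (k x) = g (t x).
  rewrite cE linear_sum; apply: eq_bigr => i _.
  by rewrite hhE linearZ.
by rewrite tE dE /= subrK.
Qed.

(** The indices are treated from the largest down: layers Delta(j) added later do no harm, since
    Ext^1(Delta(l), Delta(j)) = 0 for [l > j]. *)
Lemma universal_extension X : fin X -> exists Y X1 (g : {linear X -> Y}) (p : {linear Y -> X1}),
  [/\ ses g p, filt (Delta e) X1 & Dperp finA he Y].
Proof.
move=> finX.
suff main t : exists Y X1 (g : {linear X -> Y}) (p : {linear Y -> X1}),
    [/\ ses g p, filt (Delta e) X1 & forall l : 'I_n, (n - t <= l)%N -> ext0 (D l) Y].
  have [Y [X1 [g [p [gp FX1 eY]]]]] := main n.
  by exists Y, X1, g, p; split=> // l; apply: eY; rewrite subnn.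
elim: t => [|t [Y [X1 [g [p [gp FX1 eY]]]]]].
  have [Z [p [gp Z0]]] := ses_zero_r X.
  exists X, Z, (idfun : {linear X -> X}), p; split=> //; first exact: Filt0.
  by move=> l; rewrite subn0 leqNgt ltn_ord.
(* Once [t] reaches [n], the truncated subtraction is already 0 and every index is covered. *)
have [nt|tn] := leqP n t.
  exists Y, X1, g, p; split=> // l _; apply: eY.
  by move: nt; rewrite -subn_eq0 => /eqP ->.
have jP : (n - t.+1 < n)%N by rewrite ltn_subrL (leq_ltn_trans _ tn).
pose j := Ordinal jP.
have finY : fin Y by apply: fin_ses gp finX _; exact: filt_Delta_fin FX1.
have [Y' [X2 [g' [p' [gp' FX2 eY']]]]] := universal_extension_step j finY.
have [W [q [i [r [gq ir]]]]] := ses_comp gp gp'.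
exists Y', W, (g' \o g), q; split=> //.
  apply: (filt_ses ir FX1); apply: filt_mono FX2 => _ <-.
  exact: Dmod_Delta.
move=> l; rewrite leq_eqVlt => /orP [/eqP jl|jl].
  by have -> : l = j by exact/val_inj.
apply: (ext0_middle_r (Dmod_presented finA he l) gp').
  by apply: eY; rewrite subnSK in jl.
apply: ext0_Dmod_dead => l' ll'; apply: filt_Dmod_dead FX2 _.
exact: ltn_trans ll'.
Qed.

End UniversalExtensions.

(** * Comparison of the two dimensions *)

Theorem proposition2p2 (R : comNzRingType) (A : algType R) (n : nat)
    (e : 'I_n -> A) (I : 'I_n -> lmodType A) (T : lmodType A) (s : nat)
    (hA : artin_algebra A)
    (he : complete_primitive_orthogonal e)
    (hbasic : basic_algebra e)
    (hI : forall i, fin_gen (I i) /\ injective_envelope (Emod e i) (I i))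
    (hstrat : standardly_stratified e)
    (hT : characteristic_module e I T) :
  nablabar_gfd_algebra_eq e I s <-> proj_dim_eq T s.
Proof.
have finA : fin A^o.
  apply: (fin_gen_fin_mod hA); exists 1%N, (fun=> 1) => v.
  by exists (fun=> v : A); rewrite big_ord1 -[LHS]mulr1.
have [FDT FnT] : filt (Delta e) T /\ filt (nablabar e I) T.
  by case: hT => _ _ /(_ T) [/(_ (add_class_refl T)) [/filteredE ? /filteredE ?]].
have finT : fin T by exact: filt_Delta_fin FDT.
have finE (M : lmodType A) : fin M <-> fin_gen M by exact: (fin_genP finA).
have filtE : filtered (nablabar e I) = filt (nablabar e I).
  by apply/funext => M; apply/propext/filteredE.
(* Coresolutions can be padded by zero modules, so a bound on the minimal lengths amounts to length
   [d] for all modules. *)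
have boundP d : nablabar_gfd_bound e I d <->
    forall M : lmodType A, fin M -> coresolution (filt (nablabar e I)) M d.
  rewrite /nablabar_gfd_bound /nablabar_gfd_eq filtE.
  split=> [bd M /finE /bd [d' [cM _] d'd]|cd M /finE finM].
    by apply: coresolution_mono d'd cM => Z; exact: Filt0.
  pose P k := `[< coresolution (filt (nablabar e I)) M k >].
  have exP : exists k, P k by exists d; apply/asboolP; exact: cd.
  case: (ex_minnP exP) => k /asboolP ck kmin; exists k.
    by split=> // k' ck'; apply: kmin; apply/asboolP.
  by apply: kmin; apply/asboolP; exact: cd.
(* Both dimensions are least values of [d], so an equivalence for each [d] makes them agree. *)
suff main d : nablabar_gfd_bound e I d <-> projective_resolution T d.
  by split=> -[Qs minQ]; split; try exact/main; move=> d /main; exact: minQ.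
rewrite boundP; split=> [bd|resT].
  apply: (resolution_of_bound (finA := finA) (he := he) hbasic hI hstrat _ finT bd) => Y finY pY.
  exact: ext0_Delta_filt pY FDT.
(* [t] bounds the distance from [m] up to [n]. At [t = 0] the bound on proj.dim Delta(j) suffices;
   otherwise the vanishing for the next cosyzygy and Ext^1(T0, Z) = 0, which comes from [m >= d],
   give it for [Z]. *)
have perp t m (Z : lmodType A) : (d <= m)%N -> (n <= m + t)%N ->
    cosyzygy m Z -> Dperp finA he Z.
  elim: t m Z => [|t IH] m Z dm nm cZ j.
    by apply: (ext0_Dmod_cosyzygy hstrat _ cZ); rewrite addn0 in nm; exact: leq_trans (leq_addr _ _).
  have [Z' [Q [g [p [cZ' injQ finQ gp]]]]] := cosyzygyS finA he hI cZ.
  have [T0 [X1 [i [q [iq FX1 pT0]]]]]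
    := universal_extension hA finA he hstrat (Dmod_fin (finA := finA) (he := he) (i := j)).
  have FT0 : filt (Delta e) T0 by exact: filt_ses iq (filt_one (Dmod_Delta finA he j)) FX1.
  have finT0 : fin T0 by exact: filt_Delta_fin FT0.
  have addT0 : add_class T T0.
    case: hT => _ _ /(_ T0) [_]; apply; split; apply/filteredE => //.
    exact: (filt_nablabar hbasic hI hstrat finT0 pT0).
  apply: (ext0_syzygy iq gp); first exact: ext0_inj.
    by apply: ext0_add_class addT0 _; exact: ext0_resolution_cosyzygy resT dm cZ.
  apply: ext0_Delta_filt FX1; apply: IH cZ'; first exact: leqW.
  by rewrite addSnnS.
have perp' m (Z : lmodType A) : (d <= m)%N -> cosyzygy m Z -> Dperp finA he Z.
  by move=> dm; apply: (perp n) => //; exact: leq_addl.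
(* An injective coresolution is cut off where the cosyzygy index reaches [d], with [k] the remaining
   length; the injective terms and the last cosyzygy all lie in [Dperp]. *)
suff core k m (Z : lmodType A) : (d <= m + k)%N -> cosyzygy m Z ->
    coresolution (filt (nablabar e I)) Z k.
  by move=> M finM; apply: (core d 0%N).
elim: k m Z => [|k IH] m Z dm cZ.
  apply: coresolution0; apply: (filt_nablabar (finA := finA) (he := he)) => //; first exact: cosyzygy_fin cZ.
  by apply: perp' cZ; rewrite addn0 in dm.
have [Z' [Q [g [p [cZ' injQ finQ gp]]]]] := cosyzygyS finA he hI cZ.
apply: (coresolutionS gp); last by apply: IH cZ'; rewrite addSnnS.
by apply: (filt_nablabar (finA := finA) (he := he)) => //; exact: Dperp_injective.
Qed.
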